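(* Let $C:\operatorname{Sym}^2\mathbb C^3\to\mathbb C^3$ be a constant symmetric bilinear map and let $Q_C(Y;z,a)=\sum_{|\alpha|\leqslant d}q_\alpha(z,a)Y^\alpha$ be the corrected parameter polynomial attached to $C$ (defined in the context). The vector field $$V_C=\sum_\alpha q_\alpha(z,a)\,\partial_{a_\alpha}+C(\xi^{(1)},\xi^{(1)})\cdot\partial_{\xi^{(2)}}$$ is tangent to $E_0=E_1=E_2=0$, is reparametrization equivariant, and homogenises with base twist $\mathcal O_{\mathbb P^3}(3)$. It extends holomorphically over the second Semple stage.
   Context: On an affine chart $z=(z_1,z_2,z_3)$ of $\mathbb P^3$ write the universal degree-$d$ polynomial as $F(z,a)=\sum_{|\alpha|\leqslant d}a_\alpha z^\alpha$, with partial derivatives $F_r=\partial F/\partial z_r$. Vertical two-jets (2-jets of curves in the fibres $\{F(\cdot,a)=0\}$) have coordinates $(z,a,\xi^{(1)},\xi^{(2)})$ with $\xi^{(1)},\xi^{(2)}\in\mathbb C^3$ the first and second derivatives, and are cut out by $E_0=F$, $E_1=dF(\xi^{(1)})$, $E_2=dF(\xi^{(2)})+d^2F(\xi^{(1)},\xi^{(1)})$. Definition of $Q_C$: start from $Q_0(Y;z,a)=-\frac12\sum_{r,j,k}C^r_{jk}F_r(Y,a)(Y_j-z_j)(Y_k-z_k)$, which has degree at most $d+1$ in $Y$. Write its homogeneous part of $Y$-degree $d+1$ as $\sum_{|\alpha|=d+1}h_\alpha Y^\alpha$, choose for each such $\alpha$ some $\gamma(\alpha)\leqslant\alpha$ with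 $|\gamma(\alpha)|=3$, and set $Q_C=Q_0-\sum_{|\alpha|=d+1}h_\alpha(Y-z)^{\gamma(\alpha)}Y^{\alpha-\gamma(\alpha)}$. Then $Q_C$ has $Y$-degree at most $d$, is linear in $a$, and $\deg_z q_\alpha\leqslant3$. ''Reparametrization equivariant'' means compatible with the action of the group of 2-jets of changes of parameter on $(\xi^{(1)},\xi^{(2)})$. ''Homogenises with base twist $\mathcal O_{\mathbb P^3}(3)$'' means that, over all projective charts of $\mathbb P^3$, it defines a section of the tangent sheaf of the vertical two-jet space twisted by the pullback of $\mathcal O_{\mathbb P^3}(3)$ (i.e. it has pole order at most $3$ along the hyperplane at infinity). ''Second Semple stage'': for the relative Demailly–Semple tower $X_1=P(T_X)$, $X_2=P(V_1)$ of the universal surface (with $V_1\subset T_{X_1}$ the vectors projecting to the tautological line), the field induced on (the twisted tangent sheaf of) $X_2$ is holomorphic, including along the stationary divisor $P(T_{X_1/X})$. In tangent-frame jet coordinates $(x,y,X,Y)$ with $W=xY-yX$, the second-stage charts over $x\neq0$ are $q=W/x^3$ and $r=1/q$, and similarly over $y\ne0$. *)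

(* Defs.v *)
From HB Require Import structures.
From mathcomp Require Import all_boot all_order all_algebra.
From mathcomp.multinomials Require Import -(notations) mpoly.
From mathcomp Require Import complex.
From mathcomp Require Import all_classical all_reals.
From mathcomp Require Import topology normedtype derive.

Set Implicit Arguments.
Unset Strict Implicit.
Unset Printing Implicit Defensive.

Import Order.TTheory GRing.Theory Num.Theory.
Import numFieldNormedType.Exports.

Local Open Scope ring_scope.
Local Open Scope classical_set_scope.

(* The complex numbers, packaged so that matrices and products over them get
   their normed module structures; [differentiable] over [CC R] is complex
   differentiability, i.e. holomorphy on open sets. *)
Definition CC (R : realType) : numFieldType := (R[i])%C.

Section Jets.
Variables (K : numFieldType) (d : nat).

(* Multi-indices alpha in N^3 with |alpha| <= d. *)
Definition mindex := bmultinom 3 d.+1.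

Definition params := 'rV[K]_#|{: mindex}|.

(* Points (z, a, xi1, xi2); xi1 and xi2 are the first and second derivatives. *)
Definition jet := ('rV[K]_3 * params * 'rV[K]_3 * 'rV[K]_3)%type.
Definition jz (p : jet) : 'rV[K]_3 := p.1.1.1.
Definition ja (p : jet) : params := p.1.1.2.
Definition jxi1 (p : jet) : 'rV[K]_3 := p.1.2.
Definition jxi2 (p : jet) : 'rV[K]_3 := p.2.

Definition coef (a : params) (al : mindex) : K := a 0 (enum_rank al).

Definition univ_poly (a : params) : mpoly 3 K :=
  \sum_(al : mindex) coef a al *: mpolyX K (val al).

Definition evalz (q : mpoly 3 K) (z : 'rV[K]_3) : K := meval (fun j => z 0 j) q.

Definition Fz (z : 'rV[K]_3) (a : params) : K := evalz (univ_poly a) z.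
Definition dFz (r : 'I_3) (z : 'rV[K]_3) (a : params) : K :=
  evalz (mderiv r (univ_poly a)) z.
Definition ddFz (r s : 'I_3) (z : 'rV[K]_3) (a : params) : K :=
  evalz (mderiv s (mderiv r (univ_poly a))) z.

Definition E0 (p : jet) : K := Fz (jz p) (ja p).
Definition E1 (p : jet) : K := \sum_r dFz r (jz p) (ja p) * jxi1 p 0 r.
Definition E2 (p : jet) : K :=
  \sum_r dFz r (jz p) (ja p) * jxi2 p 0 r +
  \sum_r \sum_s ddFz r s (jz p) (ja p) * jxi1 p 0 r * jxi1 p 0 s.

Definition vertical_jet (p : jet) : Prop := [/\ E0 p = 0, E1 p = 0 & E2 p = 0].

Definition tangent_to_vertical_jets (V : jet -> jet) : Prop :=
  forall p, vertical_jet p ->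
  [/\ is_derive p (V p) E0 0, is_derive p (V p) E1 0 & is_derive p (V p) E2 0].

Section Field.
(* C r j k is the coefficient C^r_jk: C(u, v)_r = sum_jk C^r_jk u_j v_k. *)
Variable C : 'I_3 -> 'I_3 -> 'I_3 -> K.
Variable gamma : multinom 3 -> multinom 3.

Definition bilin (u v : 'rV[K]_3) : 'rV[K]_3 :=
  \row_r \sum_j \sum_k C r j k * u 0 j * v 0 k.

(* Polynomials in Y; [Yz z j] is Y_j - z_j. *)
Definition Yz (z : 'rV[K]_3) (j : 'I_3) : mpoly 3 K :=
  mpolyX K (mnm1 j) - mpolyC 3 (z 0 j).

Definition Q0 (z : 'rV[K]_3) (a : params) : mpoly 3 K :=
  - (2%:R^-1 *: \sum_r \sum_j \sum_k
       C r j k *: (mderiv r (univ_poly a) * Yz z j * Yz z k)).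

Definition QC (z : 'rV[K]_3) (a : params) : mpoly 3 K :=
  Q0 z a - \sum_(al : bmultinom 3 d.+2 | mdeg al == d.+1)
    mcoeff al (Q0 z a) *:
      ((\prod_j Yz z j ^+ gamma al j) * mpolyX K (mnm_sub al (gamma al))).

Definition qC (z : 'rV[K]_3) (a : params) : params :=
  \row_i mcoeff (val (enum_val i)) (QC z a).

Definition VC (p : jet) : jet :=
  (0, qC (jz p) (ja p), 0, bilin (jxi1 p) (jxi1 p)).
End Field.

(* The action of the 2-jet of a change of parameter with first and second
   derivatives l and m at the base point. *)
Definition reparam (l m : K) (p : jet) : jet :=
  (jz p, ja p, l *: jxi1 p, l ^+ 2 *: jxi2 p + m *: jxi1 p).

Definition reparam_equivariant (V : jet -> jet) : Prop :=
  forall l m p, l != 0 -> is_derive p (V p) (reparam l m) (V (reparam l m p)).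

(* Projective charts.  [None] is the chart Z_0 != 0 with coordinates
   z_j = Z_j / Z_0; [Some i] is the chart Z_i != 0, whose coordinates are
   numbered w_i = Z_0 / Z_i and w_j = Z_j / Z_i for j != i.  With this
   numbering, w_i^d F(z, a) = F(w, b) where b is a permutation of a, so the
   vertical jets are given by the same equations E0, E1, E2 in each chart. *)
Definition chart := option 'I_3.

Definition in_chart (c : chart) (z : 'rV[K]_3) : bool :=
  if c is Some i then z 0 i != 0 else true.

Definition chart_pt (c : chart) (z : 'rV[K]_3) : 'rV[K]_3 :=
  if c is Some i then \row_j (if j == i then (z 0 i)^-1 else z 0 j / z 0 i)
  else z.

Definition chart_mnm (c : chart) (al : multinom 3) : multinom 3 :=
  if c is Some i then
    Multinom [tuple if j == i then (d - mdeg al)%N else al j | j < 3]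
  else al.

Definition chart_params (c : chart) (a : params) : params :=
  \row_i mcoeff (chart_mnm c (val (enum_val i))) (univ_poly a).

(* First and second derivatives at 0 of the image under the change of chart of
   the curve t |-> z + t xi1 + t^2/2 xi2. *)
Definition chart_jet (c : chart) (p : jet) : jet :=
  let g (j : 'I_3) (t : K) :=
    chart_pt c (jz p + t *: jxi1 p + (t ^+ 2 / 2%:R) *: jxi2 p) 0 j in
  (chart_pt c (jz p), chart_params c (ja p),
   \row_j (g j)^`() 0, \row_j (g j)^`(2) 0).

(* Z_0 / Z_i in the coordinates of the chart: an equation of the hyperplane at
   infinity Z_0 = 0. *)
Definition infty_eq (c : chart) (w : 'rV[K]_3) : K :=
  if c is Some i then w 0 i else 1.

(* V, given over the chart Z_0 != 0, times Z_0^e is a section of the tangent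
   sheaf of the vertical two-jet space twisted by O(e): in each chart, after
   multiplication by (Z_0 / Z_i)^e it extends to a holomorphic field W. *)
Definition homogenises_with_twist (e : nat) (V : jet -> jet) : Prop :=
  forall c : chart, exists W : jet -> jet,
  [/\ forall p, differentiable W p,
      tangent_to_vertical_jets W
    & forall p, vertical_jet p -> in_chart c (jz p) ->
      is_derive p (V p) (chart_jet c)
        ((infty_eq c (jz (chart_jet c p)) ^+ e)^-1 *: W (chart_jet c p))].

(* Where F_k != 0, the fibre surface has local coordinates (z_m, z_n), with
   {k, m, n} = {1, 2, 3}.  In the tangent frame e_i = d_i - (F_i / F_k) d_k
   (i = m, n) the jet coordinates (x, y, X, Y) are the m-th and n-th entries of
   xi1 and xi2.  Over x != 0, X_1 has the fibre coordinate u = y / x, and V_1 is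
   spanned by D = d_m + u d_n (lifted to X) and d_u.  The lift of a jet to X_1
   has velocity x D + (W / x^2) d_u with W = x Y - y X, so that its class in
   P(V_1) is [1 : q] with q = W / x^3; the coordinate r = 1 / q is used near the
   stationary divisor r = 0.  Exchanging m and n gives the charts over y != 0. *)
Definition frame (k m n : 'I_3) : bool := uniq [:: k; m; n].

Definition wronskian (m n : 'I_3) (p : jet) : K :=
  jxi1 p 0 m * jxi2 p 0 n - jxi1 p 0 n * jxi2 p 0 m.

(* Points (z, a, u, s), s being q or r. *)
Definition semple := ('rV[K]_3 * params * K * K)%type.
Definition sz (x : semple) : 'rV[K]_3 := x.1.1.1.
Definition sa (x : semple) : params := x.1.1.2.

(* Coordinates on X_2 near the generic points ([false], s = q) or near the
   stationary divisor ([true], s = r). *)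
Definition semple_lift (m n : 'I_3) (stat : bool) (p : jet) : semple :=
  let q := wronskian m n p / jxi1 p 0 m ^+ 3 in
  (jz p, ja p, jxi1 p 0 n / jxi1 p 0 m, if stat then q^-1 else q).

Definition lifts_in (k m n : 'I_3) (stat : bool) (p : jet) : bool :=
  [&& dFz k (jz p) (ja p) != 0, jxi1 p 0 m != 0
    & stat ==> (wronskian m n p != 0)].

(* The chart of X_2 is the smooth hypersurface F(z, a) = 0 in the open set
   F_k(z, a) != 0 of the (z, a, u, s)-space. *)
Definition holomorphic_on_semple_chart (k : 'I_3) (U : semple -> semple) : Prop :=
  (forall x, dFz k (sz x) (sa x) != 0 -> differentiable U x) /\
  (forall x, dFz k (sz x) (sa x) != 0 -> Fz (sz x) (sa x) = 0 ->
     is_derive x (U x) (fun y : semple => Fz (sz y) (sa y)) 0).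

(* In each chart of X_2, over each chart of P^3, the field induced by V on the
   lifts of vertical jets, multiplied by (Z_0 / Z_i)^e, extends to a holomorphic
   field U on the whole chart.  Such a U is unique on X_2, the lifts being
   dense, so that the fields U agree where the charts overlap. *)
Definition extends_over_second_semple_stage (e : nat) (V : jet -> jet) : Prop :=
  forall (c : chart) (k m n : 'I_3) (stat : bool), frame k m n ->
  exists U : semple -> semple,
    holomorphic_on_semple_chart k U /\
    forall p, vertical_jet p -> in_chart c (jz p) ->
      lifts_in k m n stat (chart_jet c p) ->
      is_derive p (V p) (semple_lift m n stat \o chart_jet c)
        ((infty_eq c (jz (chart_jet c p)) ^+ e)^-1 *:
           U (semple_lift m n stat (chart_jet c p))).
End Jets.

(* Main.v *)
Require Import Defs.
From mathcomp Require Import all_boot all_order all_algebra.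
From mathcomp.multinomials Require Import -(notations) mpoly.
From mathcomp Require Import all_classical all_reals.
From mathcomp Require Import topology normedtype derive.
From mathcomp Require Import ring zify.

(* Q_C vanishes to second order at Y = z with Hessian -dF(C(.,.)), which gives
   tangency in the affine chart: the equations E_0, E_1, E_2 are affine along
   the lines directed by V_C, so their derivatives need no calculus.

   In another chart put e = Z_0 / Z_i, let psi be the change of chart and
   F' the equation of the surface, so that F'(w) = e(w)^d F(psi(w)).  Since psi
   maps lines to lines, psi(w + t v) = psi(w) + t rho(w, v) / (e(w) e(w + t v))
   with rho polynomial, and comparing the expansions in t of both sides of the
   equation relates the derivatives of F' to those of F.  As q_alpha has degree
   at most 3 in z, the parameter part of e^3 V_C is a polynomial G(w, b); the
   second-derivative part is a polynomial A(w, xi1) with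
   rho(w, A) = e(w) C(rho, rho).  Hence
     F'(G) = 0,  dF'(G) = 0,
     dF'(A) + d^2F'(G)(xi1, xi1) = d kappa F',
   first where e(w) <> 0, then everywhere by continuity.

   On the Semple charts xi1 = x eps(u, w, b) along vertical jets and A is
   homogeneous of degree 2 in xi1, so the rate of q = W / x^3 is
   A_n(eps) - u A_m(eps), which involves neither x nor q, and that of r = 1 / q
   is -r^2 times it. *)

Set Implicit Arguments.
Unset Strict Implicit.
Unset Printing Implicit Defensive.

Import Order.TTheory GRing.Theory Num.Theory.
Import numFieldNormedType.Exports.

Local Open Scope ring_scope.
Local Open Scope classical_set_scope.

(** * Differential calculus over a numeric field *)

Section Analysis.
Variable K : numFieldType.

Lemma eq_at_puncture (f g : K -> K) (t0 : K) :
  {for t0, continuous f} -> {for t0, continuous g} ->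
  (\forall t \near t0^', f t = g t) -> f t0 = g t0.
Proof.
move=> cf cg fg.
have cf' : f @ t0^' --> f t0 by apply: cvg_trans cf; exact/cvg_app/nbhs_dnbhs.
have cg' : g @ t0^' --> g t0 by apply: cvg_trans cg; exact/cvg_app/nbhs_dnbhs.
have cfg : f @ t0^' --> g t0.
  by apply: cvg_trans cg'; apply: near_eq_cvg; apply: filterS fg => t ->.
exact: cvg_unique cf' cfg.
Qed.

Lemma near_puncture_neq (f : K -> K) (t0 : K) :
  {for t0, continuous f} -> f t0 != 0 -> \forall t \near t0^', f t != 0.
Proof.
move=> cf f0; apply: nbhs_dnbhs.
exact: cvgr_neq0 cf f0.
Qed.

(* Caratheodory's form of the derivative: no remainder estimate is needed. *)
Lemma is_derive_slope (V W : normedModType K) (f : V -> W) (p v : V)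
    (S : K -> W) :
  (\forall h \near 0^', f (h *: v + p) = f p + h *: S h) ->
  {for 0, continuous S} -> is_derive p v f (S 0).
Proof.
move=> fS cS.
have cv : (fun h => h^-1 *: ((f \o shift p) (h *: v) - f p)) @ 0^' --> S 0.
  have cS' : S @ 0^' --> S 0 by apply: cvg_trans cS; exact/cvg_app/nbhs_dnbhs.
  apply: cvg_trans cS'; apply: near_eq_cvg.
  near=> h; rewrite /= (near fS h) //.
  rewrite addrAC subrr add0r scalerA mulVf ?scale1r //.
  by near: h; exact: nbhs_dnbhs_neq.
split; first by apply/cvg_ex; exists (S 0).
exact: (cvg_lim (@norm_hausdorff _ _)).
Unshelve. all: by end_near. Qed.

Lemma is_derive_affine (V W : normedModType K) (f : V -> W) (p v : V) (A : W) :
  (forall h, f (h *: v + p) = f p + h *: A) -> is_derive p v f A.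
Proof.
move=> fA; apply: (is_derive_slope (S := fun=> A)); first exact: nearW.
exact: cst_continuous.
Qed.

Section Differentiability.
Variable V : normedModType K.
Implicit Types (f g : V -> K) (x : V).

Lemma differentiable_bigsum (I : Type) (r : seq I) (P : pred I)
    (W : normedModType K) (F : I -> V -> W) x :
  (forall i, P i -> differentiable (F i) x) ->
  differentiable (fun y => \sum_(i <- r | P i) F i y) x.
Proof.
move=> dF; elim: r => [|i r IH].
  under eq_fun do rewrite big_nil; exact: differentiable_cst.
under eq_fun do rewrite big_cons.
case: (boolP (P i)) => [Pi|_] //.
exact: differentiableD (dF _ Pi) IH.
Qed.

Lemma differentiable_exp f n x :
  differentiable f x -> differentiable (fun y => f y ^+ n) x.
Proof.
move=> df; case: n => [|n]; first exact: differentiable_cst.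
by have := differentiableX n df; rewrite exprfctE.
Qed.

Lemma differentiable_mul f g x : differentiable f x -> differentiable g x ->
  differentiable (fun y => f y * g y) x.
Proof. exact: differentiableM. Qed.

Lemma differentiable_bigprod (I : Type) (r : seq I) (P : pred I)
    (F : I -> V -> K) x :
  (forall i, P i -> differentiable (F i) x) ->
  differentiable (fun y => \prod_(i <- r | P i) F i y) x.
Proof.
move=> dF; elim: r => [|i r IH].
  under eq_fun do rewrite big_nil; exact: differentiable_cst.
under eq_fun do rewrite big_cons.
case: (boolP (P i)) => [Pi|_] //.
exact: differentiable_mul (dF _ Pi) IH.
Qed.

Lemma differentiable_row n (F : V -> 'rV[K]_n) x :
  (forall j, differentiable (fun y => F y 0 j) x) -> differentiable F x.
Proof.
move=> dF.
have -> : F = fun y => \sum_j F y 0 j *: delta_mx 0 j.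
  by apply/funext => y; exact: row_sum_delta.
by apply: differentiable_bigsum => j _; exact: differentiableZl.
Qed.

Lemma differentiable_coef n (F : V -> 'rV[K]_n) j x :
  differentiable F x -> differentiable (fun y => F y 0 j) x.
Proof.
by move=> dF; exact: (differentiable_comp dF (differentiable_coord _ _ _)).
Qed.

End Differentiability.

Lemma differentiable_fst (U V W : normedModType K) (f : W -> U * V) x :
  differentiable f x -> differentiable (fun y => (f y).1) x.
Proof.
move=> df; have dfst : differentiable (fst : U * V -> U) (f x).
  by apply: linear_differentiable => y; exact: cvg_fst.
exact: (differentiable_comp df dfst).
Qed.

Lemma differentiable_snd (U V W : normedModType K) (f : W -> U * V) x :
  differentiable f x -> differentiable (fun y => (f y).2) x.
Proof.
move=> df; have dsnd : differentiable (snd : U * V -> V) (f x).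
  by apply: linear_differentiable => y; exact: cvg_snd.
exact: (differentiable_comp df dsnd).
Qed.

Lemma differentiable_horner (p : {poly K}) (x : K) :
  differentiable (horner p) x.
Proof.
have -> : horner p = fun y => \sum_(i < size p) p`_i * y ^+ i.
  by apply/funext => y; rewrite horner_coef.
apply: differentiable_bigsum => i _; apply: differentiable_mul.
  exact: differentiable_cst.
exact/differentiable_exp.
Qed.

Lemma horner_drop (p : {poly K}) (t : K) :
  p.[t] = p`_0 + t * (drop_poly 1 p).[t].
Proof.
rewrite -[in LHS](poly_take_drop 1 p) !hornerE [_ * t]mulrC.
suff -> : take_poly 1 p = (p`_0)%:P by rewrite hornerC.
by apply/polyP => -[|i]; rewrite coef_take_poly coefC.
Qed.

Lemma continuous_muln (n : nat) (S : K -> K) :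
  {for 0, continuous S} -> {for 0, continuous (fun t : K => t ^+ n * S t)}.
Proof.
move=> cS; have cX : {for 0, continuous (fun t : K => t ^+ n)}.
  by apply: differentiable_continuous; exact: differentiable_exp.
exact: (cvgM cX cS).
Qed.

Lemma poly_expansion1 (p : {poly K}) (A : K) (S : K -> K) :
  {for 0, continuous S} ->
  (\forall t \near 0^', p.[t] = A + t * S t) -> p`_0 = A /\ p`_1 = S 0.
Proof.
move=> cS pS.
have cp (q : {poly K}) : {for 0, continuous (horner q : K -> K)}.
  by apply: differentiable_continuous; exact: differentiable_horner.
have p0 : p`_0 = A.
  rewrite -horner_coef0 (@eq_at_puncture _ (fun t => A + t * S t) 0) //.
    by rewrite mul0r addr0.
  have cA : {for 0, continuous (fun _ : K => A)} by exact: cst_continuous.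
  exact: (cvgD cA (continuous_muln (n := 1) cS)).
split=> //; rewrite -[RHS](@eq_at_puncture (horner (drop_poly 1 p)) S 0) //.
  by rewrite horner_coef0 coef_drop_poly.
near=> t; have := near pS t; rewrite horner_drop p0.
have t0 : t != 0 by near: t; exact: nbhs_dnbhs_neq.
by move=> /(_ _)/addrI/(mulfI t0); apply.
Unshelve. all: by end_near. Qed.

Lemma poly_expansion2 (p : {poly K}) (S : K -> K) :
  {for 0, continuous S} ->
  (\forall t \near 0^', p.[t] = t ^+ 2 * S t) ->
  [/\ p`_0 = 0, p`_1 = 0 & p`_2 = S 0].
Proof.
move=> cS pS.
have [p0 p1] : p`_0 = 0 /\ p`_1 = 0 * S 0.
  apply: (@poly_expansion1 p 0 (fun t => t * S t)).
    exact: (continuous_muln (n := 1)).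
  by apply: filterS pS => t ->; rewrite add0r mulrA.
have [q0 q1] : (drop_poly 1 p)`_0 = 0 /\ (drop_poly 1 p)`_1 = S 0.
  apply: poly_expansion1 => //.
  near=> t; have := near pS t; rewrite horner_drop p0 !add0r expr2 -mulrA.
  have t0 : t != 0 by near: t; exact: nbhs_dnbhs_neq.
  by move=> /(_ _)/(mulfI t0); apply.
split=> //; first by rewrite p1 mul0r.
by rewrite -q1 coef_drop_poly.
Unshelve. all: by end_near. Qed.

End Analysis.

(** * Taylor expansion of polynomials along lines *)

Section Lines.
Variable K : numFieldType.
Implicit Types (P Q : mpoly 3 K) (w v : 'rV[K]_3).

Lemma evalzE P w :
  evalz P w = \sum_(m <- msupp P) mcoeff m P * \prod_j w 0 j ^+ m j.
Proof. by rewrite /evalz mevalE. Qed.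

Definition on_line w v : mpoly 3 K -> {poly K} :=
  mmap (polyC : K -> {poly K}) (fun j => (w 0 j)%:P + (v 0 j) *: 'X).

Lemma horner_on_line P w v t : (on_line w v P).[t] = evalz P (t *: v + w).
Proof.
rewrite evalzE /on_line /mmap horner_sum; apply: eq_bigr => m _.
rewrite hornerM hornerC /mmap1 horner_prod; congr (_ * _).
apply: eq_bigr => j _; rewrite horner_exp !hornerE !mxE.
by rewrite addrC [_ * t]mulrC.
Qed.

Lemma on_line_sum (I : Type) (r : seq I) (F : I -> mpoly 3 K) w v :
  on_line w v (\sum_(i <- r) F i) = \sum_(i <- r) on_line w v (F i).
Proof. exact: raddf_sum. Qed.

Lemma deriv_on_line P w v :
  deriv (on_line w v P) = \sum_r v 0 r *: on_line w v (mderiv r P).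
Proof.
pose chain P := deriv (on_line w v P) =
  \sum_r v 0 r *: on_line w v (mderiv r P).
have chainM A B : chain A -> chain B -> chain (A * B).
  move=> cA cB; rewrite /chain {1}/on_line rmorphM /= derivM cA cB.
  rewrite mulr_suml mulr_sumr -big_split; apply: eq_bigr => r _ /=.
  rewrite mderivM /on_line raddfD /= !rmorphM /= scalerDr.
  by rewrite scalerAl scalerAr.
have chain1 : chain 1.
  rewrite /chain /on_line rmorph1 derivC big1 // => r _.
  by rewrite -mpolyC1 mderivC raddf0 scaler0.
have chainU j : chain (mpolyX K (mnm1 j)).
  rewrite /chain /on_line mmapX mmap1U derivD derivC derivZ derivX add0r.
  rewrite (bigD1 j) //= big1 => [|r rj].
    rewrite mderivX mnm1E eqxx scale1r.
    by rewrite (_ : mnm_sub _ _ = mnm0) ?mpolyX0 ?rmorph1 ?addr0 //;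
       apply/mnmP => i; rewrite mnmBE subnn mnm0E.
  by rewrite mderivX mnm1E eq_sym (negbTE rj) scale0r raddf0 scaler0.
have chainX m : chain (mpolyX K m).
  rewrite mpolyXE_id; apply: (big_ind chain) => // j _.
  elim: (m j) => [|n IH]; first by rewrite expr0.
  by rewrite exprS; apply: chainM.
rewrite [P]mpolyE on_line_sum raddf_sum /=.
under [RHS]eq_bigr do rewrite (raddf_sum (mderiv _)) on_line_sum scaler_sumr.
rewrite exchange_big; apply: eq_bigr => m _ /=.
rewrite /on_line mmapZ /= -/(on_line w v _) derivM derivC mul0r add0r chainX.
rewrite mulr_sumr; apply: eq_bigr => r _.
by rewrite mderivZ mmapZ /= scalerAr.
Qed.

Lemma coef0_on_line P w v : (on_line w v P)`_0 = evalz P w.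
Proof. by rewrite -horner_coef0 horner_on_line scale0r add0r. Qed.

Lemma coef1_on_line P w v :
  (on_line w v P)`_1 = \sum_r evalz (mderiv r P) w * v 0 r.
Proof.
have := coef_deriv (on_line w v P) 0; rewrite mulr1n => <-.
rewrite deriv_on_line coef_sum; apply: eq_bigr => r _.
by rewrite coefZ coef0_on_line mulrC.
Qed.

Lemma coef2_on_line P w v : (on_line w v P)`_2 *+ 2 =
  \sum_r \sum_s evalz (mderiv s (mderiv r P)) w * v 0 r * v 0 s.
Proof.
rewrite -coef_deriv deriv_on_line coef_sum; apply: eq_bigr => r _.
rewrite coefZ coef1_on_line mulr_sumr; apply: eq_bigr => s _.
by rewrite mulrC mulrAC.
Qed.

Lemma differentiable_evalz (V : normedModType K) P (f : V -> 'rV[K]_3) x :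
  differentiable f x -> differentiable (fun y => evalz P (f y)) x.
Proof.
move=> df; under eq_fun do rewrite evalzE.
apply: differentiable_bigsum => m _.
apply: differentiable_mul; first exact: differentiable_cst.
apply: differentiable_bigprod => j _.
exact/differentiable_exp/differentiable_coef.
Qed.

End Lines.

(** * Projective charts *)

Section Charts.
Variable (K : numFieldType) (d : nat).
Implicit Types (c : chart) (w v z : 'rV[K]_3) (a : params K d) (t : K).

Lemma in_chartE c z : in_chart c z = (infty_eq c z != 0).
Proof. by case: c => [i|] //=; rewrite oner_neq0. Qed.

Lemma infty_eq_chart_pt c z : infty_eq c (chart_pt c z) = (infty_eq c z)^-1.
Proof. by case: c => [i|] /=; rewrite ?mxE ?eqxx ?invr1. Qed.

Lemma chart_ptK c z : infty_eq c z != 0 -> chart_pt c (chart_pt c z) = z.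
Proof.
case: c => [i|] //= zi; apply/rowP => j; rewrite !mxE eqxx.
by case: eqP => [->|_]; rewrite invrK // divfK.
Qed.

Definition infty_dir c v : K := if c is Some i then v 0 i else 0.

Definition chart_dir c w v : 'rV[K]_3 :=
  if c is Some i then
    \row_j (if j == i then - v 0 i else w 0 i * v 0 j - w 0 j * v 0 i)
  else v.

Lemma infty_eq_line c w v t :
  infty_eq c (t *: v + w) = infty_eq c w + t * infty_dir c v.
Proof. by case: c => [i|] /=; rewrite ?mxE ?mulr0 ?addr0 // addrC. Qed.

(* The change of chart maps lines to lines. *)
Lemma chart_pt_line c w v t :
  infty_eq c w != 0 -> infty_eq c (t *: v + w) != 0 ->
  chart_pt c (t *: v + w) =
  (t / (infty_eq c w * infty_eq c (t *: v + w))) *: chart_dir c w v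
    + chart_pt c w.
Proof.
case: c => [i|] /=; last by rewrite !mulr1 divr1.
rewrite !mxE => wi0 tw0; apply/rowP => j; rewrite !mxE.
by case: eqP => _; field; rewrite wi0.
Qed.

Definition mon w (m : multinom 3) : K := \prod_j w 0 j ^+ m j.

Lemma evalzX w m : evalz (mpolyX K m) w = mon w m.
Proof. by rewrite /evalz mevalX. Qed.

Lemma mcoeff_univ_poly a (al : mindex d) :
  mcoeff (val al) (univ_poly a) = coef a al.
Proof.
rewrite /univ_poly raddf_sum (bigD1 al) //= big1 => [|be ne].
  by rewrite mcoeffZ mcoeffX eqxx mulr1 addr0.
by rewrite mcoeffZ mcoeffX val_eqE (negbTE ne) mulr0.
Qed.

Lemma mcoeff_univ_poly_gt a m : (d < mdeg m)%N -> mcoeff m (univ_poly a) = 0.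
Proof.
move=> dm; rewrite /univ_poly raddf_sum big1 //= => be _.
rewrite mcoeffZ mcoeffX; case: eqP => [bem|]; last by rewrite mulr0.
by move: (bmdeg be); rewrite ltnS bem leqNgt dm.
Qed.

Lemma FzE w a : Fz w a = \sum_(al : mindex d) coef a al * mon w (val al).
Proof.
rewrite /Fz /evalz /univ_poly raddf_sum; apply: eq_bigr => al _ /=.
by rewrite mevalZ mevalX.
Qed.

Lemma mdeg_chart_mnm c (al : mindex d) :
  (mdeg (chart_mnm d c (val al)) < d.+1)%N.
Proof.
have lald : (mdeg (val al) <= d)%N by rewrite -ltnS; exact: bmdeg.
case: c => [i|] //=; rewrite mdegE (bigD1 i) //= mnmE eqxx.
under eq_bigr => j ji do rewrite mnmE (negbTE ji).
move: lald; rewrite mdegE (bigD1 i) //=.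
by set x := val al i; set y := (\sum_(_ < _ | _) _)%N; lia.
Qed.

Definition chart_mindex c (al : mindex d) : mindex d :=
  BMultinom (mdeg_chart_mnm c al).

Lemma chart_mindexK c : involutive (chart_mindex c).
Proof.
move=> al; apply: val_inj; case: c => [i|] //=.
have lald : (mdeg (val al) <= d)%N by rewrite -ltnS; exact: bmdeg.
apply/mnmP => j; rewrite !mnmE; case: (eqVneq j i) => [->|ji //].
rewrite mdegE (bigD1 i) //= mnmE eqxx.
under eq_bigr => k ki do rewrite mnmE (negbTE ki).
move: lald; rewrite mdegE (bigD1 i) //=.
by set x := val al i; set y := (\sum_(_ < _ | _) _)%N; lia.
Qed.

Lemma coef_chart_params c a al :
  coef (chart_params c a) al = coef a (chart_mindex c al).
Proof. by rewrite -[RHS]mcoeff_univ_poly /coef /chart_params mxE enum_rankK. Qed.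

Lemma params_eq (a b : params K d) : (forall al, coef a al = coef b al) -> a = b.
Proof.
by move=> ab; apply/rowP => i; have := ab (enum_val i); rewrite /coef enum_valK.
Qed.

Lemma chart_paramsK c : involutive (@chart_params K d c).
Proof.
by move=> a; apply: params_eq => al; rewrite !coef_chart_params chart_mindexK.
Qed.

Lemma mon_chart c w (al : mindex d) : infty_eq c w != 0 ->
  mon w (chart_mnm d c (val al)) = infty_eq c w ^+ d * mon (chart_pt c w) (val al).
Proof.
have lald : (mdeg (val al) <= d)%N by rewrite -ltnS; exact: bmdeg.
case: c => [i|] /=; last by rewrite expr1n mul1r.
move=> wi; rewrite /mon (bigD1 i) //= [in RHS](bigD1 i) //= mnmE !mxE eqxx.
under eq_bigr => j ji do rewrite mnmE (negbTE ji).
under [in RHS]eq_bigr => j ji do rewrite !mxE (negbTE ji) expr_div_n.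
rewrite big_split /=.
under [X in _ = _ * (_ * (_ * X))]eq_bigr do rewrite -exprVn.
rewrite prodrXr; move: lald; rewrite mdegE (bigD1 i) //=.
set x := val al i; set y := (\sum_(_ < _ | _) _)%N => lald.
set P := \prod_(_ < _ | _) _.
rewrite -[in RHS](subnK lald) !exprD !exprVn.
have wx n : w 0 i ^+ n != 0 by rewrite expf_neq0.
by field; rewrite !wx.
Qed.

Lemma Fz_chart c w a : infty_eq c w != 0 ->
  Fz w (chart_params c a) = infty_eq c w ^+ d * Fz (chart_pt c w) a.
Proof.
move=> w0; rewrite !FzE (reindex_inj (can_inj (chart_mindexK c))) mulr_sumr.
apply: eq_bigr => al _; rewrite coef_chart_params chart_mindexK mon_chart //.
by rewrite mulrCA.
Qed.
End Charts.

(** * The parameter polynomial *)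

Section Degree.
Variable K : numFieldType.
Implicit Types (P Q : mpoly 3 K) (m al be : multinom 3).

Definition deg_lt n P := forall m, (n <= mdeg m)%N -> mcoeff m P = 0.

Lemma deg_lt_le n p P : (n <= p)%N -> deg_lt n P -> deg_lt p P.
Proof. by move=> np Pn m /(leq_trans np)/Pn. Qed.

Lemma deg_ltD n P Q : deg_lt n P -> deg_lt n Q -> deg_lt n (P + Q).
Proof. by move=> hP hQ m nm; rewrite mcoeffD hP ?hQ ?addr0. Qed.

Lemma deg_ltB n P Q : deg_lt n P -> deg_lt n Q -> deg_lt n (P - Q).
Proof. by move=> hP hQ m nm; rewrite mcoeffB hP ?hQ ?subr0. Qed.

Lemma deg_ltZ n k P : deg_lt n P -> deg_lt n (k *: P).
Proof. by move=> hP m nm; rewrite mcoeffZ hP ?mulr0. Qed.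

Lemma deg_lt_sum n (I : Type) (r : seq I) (B : pred I) (F : I -> mpoly 3 K) :
  (forall i, B i -> deg_lt n (F i)) -> deg_lt n (\sum_(i <- r | B i) F i).
Proof. by move=> hF m nm; rewrite raddf_sum big1 //= => i Bi; apply: hF. Qed.

Lemma deg_ltM n p P Q :
  deg_lt n P -> deg_lt p.+1 Q -> deg_lt (n + p)%N (P * Q).
Proof.
move=> hP hQ m nm; rewrite mcoeffM big1 // => -[k l] /= /eqP mkl.
have : (n + p <= mdeg k + mdeg l)%N by rewrite -mdegD -mkl.
have [/hP -> _|kn h] := leqP n (mdeg k); first by rewrite mul0r.
by rewrite [X in _ * X]hQ ?mulr0 //; lia.
Qed.

Lemma deg_ltX m : deg_lt (mdeg m).+1 (mpolyX K m).
Proof.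
by move=> k mk; rewrite mcoeffX; case: eqP => // km; move: mk; rewrite km ltnn.
Qed.

Definition has_lead al P := deg_lt (mdeg al) (P - mpolyX K al).

Lemma has_lead_deg al P : has_lead al P -> deg_lt (mdeg al).+1 P.
Proof.
move=> hP; rewrite -[P](subrK (mpolyX K al)).
apply: deg_ltD; last exact: deg_ltX.
by apply: deg_lt_le hP; exact: leqnSn.
Qed.

Lemma has_lead_mcoeff al P m : has_lead al P -> mdeg m = mdeg al ->
  mcoeff m P = (al == m)%:R.
Proof.
move=> hP mal; rewrite -[P](subrK (mpolyX K al)) mcoeffD hP ?mal //.
by rewrite add0r mcoeffX.
Qed.

Lemma has_leadX al : has_lead al (mpolyX K al).
Proof. by move=> m _; rewrite subrr mcoeff0. Qed.

Lemma has_leadM al be P Q :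
  has_lead al P -> has_lead be Q -> has_lead (mnm_add al be) (P * Q).
Proof.
move=> hP hQ; rewrite /has_lead mpolyXD mdegD.
have -> : P * Q - mpolyX K al * mpolyX K be =
  (P - mpolyX K al) * Q + (Q - mpolyX K be) * mpolyX K al by ring.
apply: deg_ltD; first by apply: deg_ltM => //; exact: has_lead_deg.
by rewrite addnC; apply: deg_ltM => //; exact: deg_ltX.
Qed.

Lemma has_leadYz (z : 'rV[K]_3) j : has_lead (mnm1 j) (Yz z j).
Proof.
move=> m; rewrite mdeg1 /Yz addrAC subrr add0r mcoeffN mcoeffC.
by case: eqP => [->|]; rewrite ?mdeg0 // mulr0 oppr0.
Qed.

Lemma deg_lt_Yz (z : 'rV[K]_3) j : deg_lt 2 (Yz z j).
Proof.
by move=> m m2; apply: (has_lead_deg (@has_leadYz z j)); rewrite mdeg1.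
Qed.

Lemma has_lead_prodYz (z : 'rV[K]_3) m :
  has_lead m (\prod_j Yz z j ^+ m j).
Proof.
rewrite {1}[m]multinomUE_id.
apply: (big_ind2 has_lead) => [|al P be Q|j _]; [|exact: has_leadM|].
  by rewrite -mpolyX0; exact: has_leadX.
elim: (m j) => [|n IH]; first by rewrite mulm0n expr0 -mpolyX0; exact: has_leadX.
by rewrite mulmS exprS; apply: has_leadM => //; exact: has_leadYz.
Qed.

End Degree.

Section ParameterPolynomial.
Variables (K : numFieldType) (d : nat) (C : 'I_3 -> 'I_3 -> 'I_3 -> K).
Variable gamma : multinom 3 -> multinom 3.
Hypothesis gamma_le : forall al : multinom 3, mdeg al = d.+1 ->
  (forall j, gamma al j <= al j)%N /\ mdeg (gamma al) = 3%N.
Implicit Types (z : 'rV[K]_3) (a : params K d).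

Lemma deg_lt_mderiv_univ_poly r a : deg_lt d (mderiv r (univ_poly a)).
Proof.
move=> m dm; rewrite mcoeff_mderiv mcoeff_univ_poly_gt ?mul0rn //.
by rewrite mdegD mdeg1 addn1 ltnS.
Qed.

Lemma deg_lt_Q0 z a : deg_lt d.+2 (Q0 C z a).
Proof.
rewrite /Q0 -sub0r; apply: deg_ltB; first by move=> m _; rewrite mcoeff0.
apply: deg_ltZ; do 3![apply: deg_lt_sum => ? _]; apply: deg_ltZ.
rewrite -2!addn1; apply: deg_ltM; first apply: deg_ltM.
- exact: deg_lt_mderiv_univ_poly.
- exact: deg_lt_Yz.
- exact: deg_lt_Yz.
Qed.

(* The part of top degree of Q_0 does not depend on z: the differences
   Y_j Y_k - (Y_j - z_j)(Y_k - z_k) have degree at most 1. *)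
Lemma mcoeff_Q0_top z a m : mdeg m = d.+1 ->
  mcoeff m (Q0 C z a) = mcoeff m (Q0 C 0 a).
Proof.
move=> md; apply/eqP; rewrite -subr_eq0 -mcoeffB; apply/eqP.
suff : deg_lt d.+1 (Q0 C z a - Q0 C 0 a) by apply; rewrite md.
rewrite /Q0 -opprB opprK addrC -scalerBr -sub0r.
apply: deg_ltB; first by move=> ? _; rewrite mcoeff0.
apply: deg_ltZ.
do 3![rewrite -sumrB; apply: deg_lt_sum => ? _]; rewrite -scalerBr.
apply: deg_ltZ; rewrite -!mulrA -mulrBr -addn1; apply: deg_ltM.
  exact: deg_lt_mderiv_univ_poly.
set j := (X in Yz z X * _); set k := (X in _ * Yz z X - _).
have lead2 y : has_lead (mnm_add (mnm1 j) (mnm1 k)) (Yz y j * Yz y k : mpoly 3 K).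
  by apply: has_leadM; exact: has_leadYz.
have -> : Yz z j * Yz z k - Yz 0 j * Yz 0 k =
  (Yz z j * Yz z k - mpolyX K (mnm_add (mnm1 j) (mnm1 k)))
  - (Yz 0 j * Yz 0 k - mpolyX K (mnm_add (mnm1 j) (mnm1 k))) by ring.
by have := deg_ltB (lead2 z) (lead2 0); rewrite mdegD !mdeg1.
Qed.

Lemma has_lead_correction z (al : multinom 3) : mdeg al = d.+1 ->
  has_lead al ((\prod_j Yz z j ^+ gamma al j) *
               mpolyX K (mnm_sub al (gamma al))).
Proof.
move=> /gamma_le[le _]; have {1}-> : al =
    mnm_add (gamma al) (mnm_sub al (gamma al)).
  by apply/mnmP => j; rewrite mnmDE mnmBE subnKC.
by apply: has_leadM; [exact: has_lead_prodYz|exact: has_leadX].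
Qed.

Lemma deg_lt_QC z a : deg_lt d.+1 (QC C gamma z a).
Proof.
move=> m; rewrite leq_eqVlt => /orP[/eqP md|md]; last first.
  move: m md; apply: deg_ltB; first exact: deg_lt_Q0.
  apply: deg_lt_sum => al /eqP ald; apply: deg_ltZ => k dk.
  by apply: (has_lead_deg (@has_lead_correction z al ald)); rewrite ald.
have mb : (mdeg m < d.+2)%N by rewrite -md.
rewrite /QC mcoeffB raddf_sum (bigD1 (BMultinom mb)) -?md //=.
rewrite mcoeffZ (has_lead_mcoeff (@has_lead_correction z m (esym md))) //.
rewrite eqxx mulr1 opprD addrA subrr add0r; apply/eqP; rewrite oppr_eq0; apply/eqP.
apply: big1 => al /andP[/eqP ald alm].
rewrite mcoeffZ (has_lead_mcoeff (@has_lead_correction z al ald)) ?ald //.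
by rewrite [_ == m](negbTE alm) mulr0.
Qed.

Lemma univ_poly_qC z a : univ_poly (qC C gamma z a) = QC C gamma z a.
Proof.
apply/mpolyP => m; have [dm|dm] := ltnP d (mdeg m).
  by rewrite deg_lt_QC // mcoeff_univ_poly_gt.
have mb : (mdeg m < d.+1)%N by [].
rewrite -[m]/(val (BMultinom mb : mindex d)) mcoeff_univ_poly /coef /qC mxE.
by rewrite enum_rankK.
Qed.

Definition Q_slope z a (rho : 'rV[K]_3) (s : K) : K :=
  - (2%:R^-1 * \sum_r \sum_j \sum_k
       C r j k * dFz r (s *: rho + z) a * rho 0 j * rho 0 k)
  - s * \sum_(al : bmultinom 3 d.+2 | mdeg al == d.+1)
    mcoeff al (Q0 C z a) * ((\prod_j rho 0 j ^+ gamma al j) *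
       mon (s *: rho + z) (mnm_sub al (gamma al))).

Lemma evalz_Yz z w j : evalz (Yz z j) w = w 0 j - z 0 j.
Proof. by rewrite /evalz /Yz mevalB mevalXU mevalC. Qed.

Lemma Fz_qC z a w : Fz w (qC C gamma z a) = evalz (QC C gamma z a) w.
Proof. by rewrite /Fz univ_poly_qC. Qed.

Lemma QC_slope z a rho s :
  evalz (QC C gamma z a) (s *: rho + z) = s ^+ 2 * Q_slope z a rho s.
Proof.
set w := s *: rho + z.
have wz j : evalz (Yz z j) w = s * rho 0 j.
  by rewrite evalz_Yz !mxE addrK.
rewrite /evalz /QC mevalB (raddf_sum (meval _)) /=.
rewrite /Q_slope mulrBr mulrN; congr (_ - _).
  rewrite /Q0 mevalN mevalZ mulrCA; congr (- (_ * _)).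
  do 3![rewrite !mulr_sumr ?(raddf_sum (meval _)) /=; apply: eq_bigr => ? _].
  by rewrite mevalZ !mevalM -!/(evalz _ w) !wz /dFz -/w; ring.
rewrite mulrA -exprSr mulr_sumr; apply: eq_bigr => al /eqP ald.
rewrite mevalZ mevalM -!/(evalz _ w) evalzX.
rewrite [RHS]mulrCA; congr (_ * _); rewrite mulrA; congr (_ * _).
rewrite /evalz rmorph_prod /=.
have -> : s ^+ 3 = \prod_(j < 3) s ^+ gamma al j.
  by have [_ g3] := gamma_le ald; rewrite prodrXr -mdegE g3.
rewrite -big_split /=.
apply: eq_bigr => j _; rewrite rmorphXn /= -exprMn.
by rewrite -wz.
Qed.

Lemma Q_slope0 z a rho :
  Q_slope z a rho 0 = - (2%:R^-1 * \sum_r dFz r z a * bilin C rho rho 0 r).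
Proof.
rewrite /Q_slope mul0r subr0 scale0r add0r; congr (- (_ * _)).
apply: eq_bigr => r _; rewrite mxE mulr_sumr; apply: eq_bigr => j _.
by rewrite mulr_sumr; apply: eq_bigr => k _; ring.
Qed.

Lemma differentiable_dFz_z (V : normedModType K) r a (f : V -> 'rV[K]_3) x :
  differentiable f x -> differentiable (fun y => dFz r (f y) a) x.
Proof. exact: differentiable_evalz. Qed.

Lemma differentiable_Q_slope z a rho s : differentiable (Q_slope z a rho) s.
Proof.
have dl : differentiable (fun t : K => t *: rho + z) s.
  apply: (differentiableD (f := fun t : K => t *: rho) (g := cst z)).
    exact: (differentiableZl (k := id)).
  exact: differentiable_cst.
apply: differentiableB.
  apply: differentiableN; apply: differentiable_mul; first exact: differentiable_cst.
  do 3![apply: differentiable_bigsum => ? _].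
  do 2![apply: differentiable_mul; last exact: differentiable_cst].
  apply: differentiable_mul; first exact: differentiable_cst.
  exact: differentiable_dFz_z.
apply: differentiable_mul => //.
apply: differentiable_bigsum => al _.
apply: differentiable_mul; first exact: differentiable_cst.
apply: differentiable_mul; first exact: differentiable_cst.
apply: differentiable_bigprod => j _.
exact/differentiable_exp/differentiable_coef.
Qed.

End ParameterPolynomial.

(** * Order of poles along the hyperplane at infinity *)

Section Poles.
Variables (K : numFieldType) (d : nat) (c : chart).
Implicit Types (f g : 'rV[K]_3 -> params K d -> K).

Definition has_pole n f :=
  exists g : 'rV[K]_3 * params K d -> K,
    (forall x, differentiable g x) /\
    forall w b, infty_eq c w != 0 ->
      g (w, b) = infty_eq c w ^+ n * f (chart_pt c w) (chart_params c b).

Lemma differentiable_infty_eq (V : normedModType K) (h : V -> 'rV[K]_3) x :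
  differentiable h x -> differentiable (fun y => infty_eq c (h y)) x.
Proof.
move=> dh; case: c => [i|] /=; first exact: differentiable_coef.
exact: differentiable_cst.
Qed.

Lemma differentiable_coef_params (V : normedModType K) (h : V -> params K d)
    al x :
  differentiable h x -> differentiable (fun y => coef (h y) al) x.
Proof. exact: differentiable_coef. Qed.

Lemma has_pole_ext n f g : (forall z a, f z a = g z a) ->
  has_pole n f -> has_pole n g.
Proof.
by move=> fg [F [dF Fe]]; exists F; split=> // w b w0; rewrite Fe // fg.
Qed.

Lemma has_pole_le n p f : (n <= p)%N -> has_pole n f -> has_pole p f.
Proof.
move=> np [g [dg ge]]; exists (fun x => infty_eq c x.1 ^+ (p - n) * g x); split.
  move=> x; apply: differentiable_mul => //.
  exact/differentiable_exp/differentiable_infty_eq/differentiable_fst.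
by move=> w b w0 /=; rewrite ge // mulrA -exprD subnK.
Qed.

Lemma has_pole_cst k : has_pole 0 (fun _ _ => k).
Proof.
exists (fun=> k); split; first by move=> x; exact: differentiable_cst.
by move=> w b _; rewrite mul1r.
Qed.

Lemma has_pole_coord j : has_pole 1 (fun z _ => z 0 j).
Proof.
rewrite /has_pole; case: c => [i|] /=; last first.
  exists (fun x : 'rV[K]_3 * params K d => x.1 0 j); split; last by move=> w b _ /=; rewrite mul1r.
  by move=> x; apply: differentiable_coef; exact: differentiable_fst.
exists (fun x : 'rV[K]_3 * params K d => if j == i then 1 else x.1 0 j); split.
  move=> x; case: eqP => _; first exact: differentiable_cst.
  by apply: differentiable_coef; exact: differentiable_fst.
move=> w b w0; rewrite mxE expr1; case: eqP => _; first by rewrite divff.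
by rewrite mulrC divfK.
Qed.

Lemma has_pole_coef al : has_pole 0 (fun _ a => coef a al).
Proof.
exists (fun x : 'rV[K]_3 * params K d => coef (chart_params c x.2) al); split.
  move=> x; under eq_fun do rewrite coef_chart_params.
  by apply: differentiable_coef_params; exact: differentiable_snd.
by move=> w b _; rewrite mul1r.
Qed.

Lemma has_poleD n f g : has_pole n f -> has_pole n g ->
  has_pole n (fun z a => f z a + g z a).
Proof.
move=> [F [dF Fe]] [G [dG Ge]]; exists (fun x => F x + G x); split.
  by move=> x; exact: differentiableD.
by move=> w b w0; rewrite Fe // Ge // mulrDr.
Qed.

Lemma has_poleM n p f g : has_pole n f -> has_pole p g ->
  has_pole (n + p) (fun z a => f z a * g z a).
Proof.
move=> [F [dF Fe]] [G [dG Ge]]; exists (fun x => F x * G x); split.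
  by move=> x; exact: differentiable_mul.
by move=> w b w0; rewrite Fe // Ge // exprD mulrACA.
Qed.

Lemma has_poleZ n k f : has_pole n f -> has_pole n (fun z a => k * f z a).
Proof. exact: has_poleM (has_pole_cst k). Qed.

Lemma has_pole_sum n (I : Type) (r : seq I) (P : pred I)
    (F : I -> 'rV[K]_3 -> params K d -> K) :
  (forall i, P i -> has_pole n (F i)) ->
  has_pole n (fun z a => \sum_(i <- r | P i) F i z a).
Proof.
move=> hF; elim: r => [|i r IH].
  apply: (has_pole_ext (f := fun _ _ => 0)); first by move=> z a; rewrite big_nil.
  exact: has_pole_le (has_pole_cst 0).
have [Pi|nPi] := boolP (P i).
  apply: has_pole_ext (has_poleD (hF i Pi) IH) => z a.
  by rewrite big_cons Pi.
by apply: has_pole_ext IH => z a; rewrite big_cons (negbTE nPi).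
Qed.

Definition has_mpole n (P : 'rV[K]_3 -> params K d -> mpoly 3 K) :=
  forall m, has_pole n (fun z a => mcoeff m (P z a)).

Lemma has_mpole_cst P : has_mpole 0 (fun _ _ => P).
Proof. by move=> m; exact: has_pole_cst. Qed.

Lemma has_mpoleD n P Q : has_mpole n P -> has_mpole n Q ->
  has_mpole n (fun z a => P z a + Q z a).
Proof.
by move=> hP hQ m; apply: has_pole_ext (has_poleD (hP m) (hQ m)) => z a;
   rewrite mcoeffD.
Qed.

Lemma has_mpoleM n p P Q : has_mpole n P -> has_mpole p Q ->
  has_mpole (n + p) (fun z a => P z a * Q z a).
Proof.
move=> hP hQ m; apply: has_pole_ext => [z a|]; first by rewrite mcoeffM.
by apply: has_pole_sum => k _; exact: has_poleM.
Qed.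

Lemma has_mpole_scale n p f P : has_pole n f -> has_mpole p P ->
  has_mpole (n + p) (fun z a => f z a *: P z a).
Proof.
move=> hf hP m; apply: has_pole_ext (has_poleM hf (hP m)) => z a.
by rewrite mcoeffZ.
Qed.

Lemma has_mpoleZ n k P : has_mpole n P -> has_mpole n (fun z a => k *: P z a).
Proof. exact: has_mpole_scale (has_pole_cst k). Qed.

Lemma has_mpoleN n P : has_mpole n P -> has_mpole n (fun z a => - P z a).
Proof.
move=> /(has_mpoleZ (-1)) hP m; apply: has_pole_ext (hP m) => z a.
by rewrite scaleN1r.
Qed.

Lemma has_mpole_sum n (I : Type) (r : seq I) (B : pred I)
    (F : I -> 'rV[K]_3 -> params K d -> mpoly 3 K) :
  (forall i, B i -> has_mpole n (F i)) ->
  has_mpole n (fun z a => \sum_(i <- r | B i) F i z a).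
Proof.
move=> hF m; apply: has_pole_ext => [z a|]; first by rewrite raddf_sum.
by apply: has_pole_sum => i Bi; exact: hF.
Qed.

Lemma has_mpole_mderiv_univ_poly r :
  has_mpole 0 (fun _ a => mderiv r (univ_poly a)).
Proof.
move=> m; apply: has_pole_ext => [z a|].
  by rewrite mcoeff_mderiv -mulr_natl.
apply: has_poleZ; have [dm|md] := ltnP d (mdeg (mnm_add m (mnm1 r))).
  apply: has_pole_ext (has_pole_cst 0) => z a.
  by rewrite mcoeff_univ_poly_gt.
have mb : (mdeg (mnm_add m (mnm1 r)) < d.+1)%N by [].
apply: has_pole_ext (has_pole_coef (BMultinom mb)) => z a.
by rewrite -mcoeff_univ_poly.
Qed.

Lemma has_mpole_Yz j : has_mpole 1 (fun z _ => Yz z j).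
Proof.
move=> m; apply: has_pole_ext => [z a|].
  by rewrite /Yz mcoeffB mcoeffC -mulN1r [_ * _%:R]mulrC.
apply: has_poleD; first exact: has_pole_le (has_pole_cst _).
by do 2 apply: has_poleZ; exact: has_pole_coord.
Qed.

Lemma has_mpole_prodYz (m : multinom 3) :
  has_mpole (mdeg m) (fun z _ => \prod_j Yz z j ^+ m j).
Proof.
have powYz n j : has_mpole n (fun z _ => Yz z j ^+ n).
  elim: n => [|n IH] k.
    apply: has_pole_ext (has_pole_cst (mcoeff k 1)) => z a.
    by rewrite expr0.
  apply: has_pole_ext => [z a|]; first by rewrite exprS.
  exact: (has_mpoleM (has_mpole_Yz j) IH).
rewrite mdegE => k; elim: (index_enum _) k => [|j r IH] k.
  rewrite big_nil; apply: has_pole_ext (has_pole_cst (mcoeff k 1)) => z a.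
  by rewrite big_nil.
rewrite big_cons; apply: has_pole_ext => [z a|]; first by rewrite big_cons.
exact: (has_mpoleM (powYz _ j) IH).
Qed.

Variables (C : 'I_3 -> 'I_3 -> 'I_3 -> K) (gamma : multinom 3 -> multinom 3).
Hypothesis gamma_le : forall al : multinom 3, mdeg al = d.+1 ->
  (forall j, gamma al j <= al j)%N /\ mdeg (gamma al) = 3%N.

Lemma has_mpole_Q0 : has_mpole 2 (Q0 C (d := d)).
Proof.
apply: has_mpoleN; apply: has_mpoleZ.
do 3![apply: has_mpole_sum => ? _]; apply: has_mpoleZ.
apply: (has_mpoleM (n := 1)); last exact: has_mpole_Yz.
apply: (has_mpoleM (n := 0)); last exact: has_mpole_Yz.
exact: has_mpole_mderiv_univ_poly.
Qed.

Lemma has_mpole_Q0_origin : has_mpole 0 (fun _ a => Q0 C 0 a).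
Proof.
apply: has_mpoleN; apply: has_mpoleZ.
do 3![apply: has_mpole_sum => ? _]; apply: has_mpoleZ.
do 2![apply: (has_mpoleM (n := 0)); last exact: has_mpole_cst].
exact: has_mpole_mderiv_univ_poly.
Qed.

Lemma has_mpole_QC : has_mpole 3 (QC C gamma (d := d)).
Proof.
apply: has_mpoleD; first by move=> m; exact: has_pole_le (has_mpole_Q0 m).
apply: has_mpoleN; apply: has_mpole_sum => al /eqP ald.
have [_ g3] := gamma_le ald.
apply: (has_mpole_scale (n := 0)).
  apply: has_pole_ext (has_mpole_Q0_origin al) => z a.
  by rewrite [RHS]mcoeff_Q0_top.
apply: (has_mpoleM (n := 3) (p := 0)); last exact: has_mpole_cst.
by have := has_mpole_prodYz (gamma al); rewrite g3.
Qed.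

Lemma parameter_field_extends :
  exists G : 'rV[K]_3 -> params K d -> params K d,
    (forall x, differentiable (fun x => G x.1 x.2) x) /\
    forall w b, infty_eq c w != 0 ->
      G w b = infty_eq c w ^+ 3 *:
        chart_params c (qC C gamma (chart_pt c w) (chart_params c b)).
Proof.
pose m (i : 'I_#|{: mindex d}|) := val (chart_mindex c (enum_val i)).
have [g gP] := choice (fun i => has_mpole_QC (m i)).
exists (fun w b => \row_i g i (w, b)); split=> [x|w b w0].
  apply: differentiable_row => i.
  under eq_fun do rewrite mxE -surjective_pairing.
  by have [] := gP i.
apply/rowP => i; rewrite !mxE; have [_ ->//] := gP i.
by rewrite univ_poly_qC.
Qed.

End Poles.

Section JointDifferentiability.
Variables (K : numFieldType) (d : nat) (V : normedModType K).
Variables (f : V -> 'rV[K]_3) (g : V -> params K d) (x : V).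
Hypotheses (df : differentiable f x) (dg : differentiable g x).

Lemma differentiable_linear_univ_poly (D : {linear mpoly 3 K -> mpoly 3 K}) :
  differentiable (fun y => evalz (D (univ_poly (g y))) (f y)) x.
Proof.
have -> : (fun y => evalz (D (univ_poly (g y))) (f y)) = fun y =>
    \sum_(al : mindex d) coef (g y) al * evalz (D (mpolyX K (val al))) (f y).
  apply/funext => y; rewrite /univ_poly raddf_sum /evalz raddf_sum /=.
  by apply: eq_bigr => al _; rewrite linearZ /= mevalZ.
apply: differentiable_bigsum => al _.
apply: differentiable_mul; first exact: differentiable_coef_params.
exact: differentiable_evalz.
Qed.

Lemma differentiable_Fz : differentiable (fun y => Fz (f y) (g y)) x.
Proof. exact: (differentiable_linear_univ_poly idfun). Qed.

Lemma differentiable_dFz r : differentiable (fun y => dFz r (f y) (g y)) x.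
Proof. exact: (differentiable_linear_univ_poly (mderiv r)). Qed.

Lemma differentiable_ddFz r s :
  differentiable (fun y => ddFz r s (f y) (g y)) x.
Proof. exact: (differentiable_linear_univ_poly (mderiv s \o mderiv r)). Qed.

End JointDifferentiability.

(** * Tangency in all charts *)

Section Acceleration.
Variables (K : numFieldType) (C : 'I_3 -> 'I_3 -> 'I_3 -> K) (c : chart).
Implicit Types w v : 'rV[K]_3.

Definition infty_accel w v : K :=
  if c is Some i then - bilin C (chart_dir c w v) (chart_dir c w v) 0 i else 0.

(* The pole-free multiple (Z_0 / Z_i)^3 of the image of C(xi1, xi1) under the
   change of chart, for a first derivative [v] at [w] in the chart [c]. *)
Definition chart_accel w v : 'rV[K]_3 :=
  let B := bilin C (chart_dir c w v) (chart_dir c w v) in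
  if c is Some i then
    \row_j (if j == i then w 0 i * infty_accel w v
            else B 0 j + w 0 j * infty_accel w v)
  else B.

Lemma bilinZ (k : K) v : bilin C (k *: v) (k *: v) = k ^+ 2 *: bilin C v v.
Proof.
apply/rowP => r; rewrite !mxE mulr_sumr; apply: eq_bigr => j _.
by rewrite mulr_sumr; apply: eq_bigr => l _; rewrite !mxE; ring.
Qed.

Lemma chart_dirZ w v (k : K) : chart_dir c w (k *: v) = k *: chart_dir c w v.
Proof.
case: c => [i|] //=; apply/rowP => j; rewrite !mxE.
by case: eqP => _; ring.
Qed.

Lemma chart_accelZ w v (k : K) :
  chart_accel w (k *: v) = k ^+ 2 *: chart_accel w v.
Proof.
rewrite /chart_accel /infty_accel chart_dirZ bilinZ; case: c => [i|] //.
move: (bilin C _ _) => B; apply/rowP => j; rewrite !mxE.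
by case: eqP => _; ring.
Qed.

Lemma chart_dir_accel w v : chart_dir c w (chart_accel w v) =
  infty_eq c w *: bilin C (chart_dir c w v) (chart_dir c w v).
Proof.
rewrite /chart_accel /infty_accel; case: c => [i|] /=; last by rewrite scale1r.
move: (bilin C _ _) => B; apply/rowP => j; rewrite !mxE eqxx.
by case: eqP => [->|_]; ring.
Qed.

Lemma infty_dir_accel w v :
  infty_dir c (chart_accel w v) = infty_eq c w * infty_accel w v.
Proof.
by rewrite /chart_accel /infty_accel; case: c => [i|] /=; rewrite ?mxE ?eqxx ?mulr0.
Qed.

Section Differentiability.
Variables (V : normedModType K) (f g : V -> 'rV[K]_3) (x : V).
Hypotheses (df : differentiable f x) (dg : differentiable g x).

Lemma differentiable_bilin_diag : differentiable (fun y => bilin C (f y) (f y)) x.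
Proof.
apply: differentiable_row => r; under eq_fun do rewrite mxE.
do 2![apply: differentiable_bigsum => ? _].
apply: differentiable_mul; last exact: differentiable_coef.
apply: differentiable_mul; last exact: differentiable_coef.
exact: differentiable_cst.
Qed.

Lemma differentiable_chart_dir :
  differentiable (fun y => chart_dir c (f y) (g y)) x.
Proof.
case: c => [i|] //=; apply: differentiable_row => j.
under eq_fun do rewrite mxE; case: eqP => _.
  by apply: differentiableN; exact: differentiable_coef.
by apply: differentiableB; apply: differentiable_mul; exact: differentiable_coef.
Qed.

End Differentiability.

Lemma differentiable_infty_accel (V : normedModType K) (f g : V -> 'rV[K]_3) x :
  differentiable f x -> differentiable g x ->
  differentiable (fun y => infty_accel (f y) (g y)) x.
Proof.
move=> df dg; have := differentiable_bilin_diag (differentiable_chart_dir df dg).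
rewrite /infty_accel; case: c => [i|] /= dB; last exact: differentiable_cst.
by apply: differentiableN; exact: (differentiable_coef _ dB).
Qed.

Lemma differentiable_chart_accel (V : normedModType K) (f g : V -> 'rV[K]_3) x :
  differentiable f x -> differentiable g x ->
  differentiable (fun y => chart_accel (f y) (g y)) x.
Proof.
move=> df dg; have dB := differentiable_bilin_diag (differentiable_chart_dir df dg).
have := differentiable_infty_accel df dg.
move: dB; rewrite /chart_accel; case: c => [i|] //= dB dk.
apply: differentiable_row => j; under eq_fun do rewrite mxE.
case: eqP => _; first by apply: differentiable_mul => //; exact: differentiable_coef.
apply: differentiableD; first exact: (differentiable_coef _ dB).
by apply: differentiable_mul => //; exact: differentiable_coef.
Qed.

End Acceleration.

Section Identities.
Variables (K : numFieldType) (d : nat) (c : chart).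
Implicit Types (w v : 'rV[K]_3) (a b : params K d).

Lemma FzD w a b (h : K) : Fz w (h *: a + b) = h * Fz w a + Fz w b.
Proof.
rewrite !FzE mulr_sumr -big_split; apply: eq_bigr => al _ /=.
by rewrite /coef !mxE; ring.
Qed.

Lemma FzZ w a (h : K) : Fz w (h *: a) = h * Fz w a.
Proof.
by rewrite !FzE mulr_sumr; apply: eq_bigr => al _; rewrite /coef !mxE mulrA.
Qed.

Lemma differentiable_line_param w v (e := infty_eq c) :
  e w != 0 ->
  differentiable (fun t : K => t / (e w * (e w + t * infty_dir c v))) 0.
Proof.
move=> w0; apply: differentiable_mul => //; apply: differentiableV.
  apply: differentiable_mul; first exact: differentiable_cst.
  apply: differentiableD; first exact: differentiable_cst.
  by apply: differentiable_mul => //; exact: differentiable_cst.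
by rewrite mul0r addr0 mulf_neq0.
Qed.

Lemma near_infty_eq_line w v : infty_eq c w != 0 ->
  \forall t \near (0 : K)^', infty_eq c w + t * infty_dir c v != 0.
Proof.
move=> w0.
apply: (near_puncture_neq (f := fun t : K => infty_eq c w + t * infty_dir c v)).
  apply: differentiable_continuous.
  apply: differentiableD; first exact: differentiable_cst.
  by apply: differentiable_mul => //; exact: differentiable_cst.
by rewrite mul0r addr0.
Qed.

Lemma dFz_chart w v a (z := chart_pt c w) (e := infty_eq c w) : e != 0 ->
  \sum_r dFz r w (chart_params c a) * v 0 r =
  e ^+ d * (d%:R * infty_dir c v / e * Fz z a +
            (e ^+ 2)^-1 * \sum_r dFz r z a * chart_dir c w v 0 r).
Proof.
move=> w0; pose e1 := infty_dir c v; pose rho := chart_dir c w v.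
pose E : {poly K} := (e%:P + e1 *: 'X) ^+ d.
pose q := on_line z rho (univ_poly a).
pose s (t : K) := t / (e * (e + t * e1)).
pose S (t : K) := (drop_poly 1 E).[t] * Fz z a +
   E.[t] / (e * (e + t * e1)) * (drop_poly 1 q).[s t].
have Et t : E.[t] = (e + t * e1) ^+ d.
  by rewrite horner_exp !hornerE [e1 * t]mulrC.
have ds : differentiable s 0 by exact: differentiable_line_param.
have cS : {for 0, continuous S}.
  apply: differentiable_continuous; apply: differentiableD.
    apply: differentiable_mul; last exact: differentiable_cst.
    exact: differentiable_horner.
  apply: differentiable_mul.
    apply: differentiable_mul; first exact: differentiable_horner.
    apply: differentiableV; last by rewrite mul0r addr0 mulf_neq0.
    apply: differentiable_mul; first exact: differentiable_cst.
    apply: differentiableD; first exact: differentiable_cst.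
    by apply: differentiable_mul => //; exact: differentiable_cst.
  exact: (differentiable_comp ds (differentiable_horner _ _)).
have [|_] := @poly_expansion1 _ (on_line w v (univ_poly (chart_params c a)))
    (e ^+ d * Fz z a) S cS.
  apply: filterS (near_infty_eq_line v w0) => t t0.
  rewrite horner_on_line -/(Fz _ _) Fz_chart infty_eq_line //.
  rewrite chart_pt_line ?infty_eq_line // -/(s t) -/z -/e -/e1 -/rho.
  rewrite -[Fz _ a]horner_on_line -/q (horner_drop q) coef0_on_line -/(Fz z a).
  rewrite -Et (horner_drop E) -horner_coef0 Et mul0r addr0 /S.
  rewrite [in RHS](horner_drop E) -horner_coef0 Et mul0r addr0 /s.
  by field; rewrite w0 andbT.
rewrite coef1_on_line => ->.
rewrite /S /s !mul0r addr0 Et mul0r addr0 !horner_coef0 !coef_drop_poly !add0n.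
rewrite coef1_on_line -/rho.
have -> : E`_1 = d%:R * e1 * e ^+ d / e.
  have := coef_deriv E 0; rewrite mulr1n => <-.
  rewrite /E deriv_exp derivD derivC derivZ derivX add0r coefMn coef0M.
  rewrite coefZ coef1 mulr1 -horner_coef0 horner_exp !hornerE.
  case: (d) => [|n /=]; first by rewrite !mulr0n !mul0r.
  by rewrite -mulr_natl exprS; field.
rewrite -/e1 -/rho [X in _ / (e * e) * X](_ : _ = \sum_r dFz r z a * rho 0 r) //.
by field.
Qed.

Variables (C : 'I_3 -> 'I_3 -> 'I_3 -> K) (gamma : multinom 3 -> multinom 3).
Hypothesis gamma_le : forall al : multinom 3, mdeg al = d.+1 ->
  (forall j, gamma al j <= al j)%N /\ mdeg (gamma al) = 3%N.

Lemma QC_chart_order2 w v a (e := infty_eq c w) (z := chart_pt c w)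
    (rho := chart_dir c w v)
    (P := on_line w v
       (univ_poly (e ^+ 3 *: chart_params c (qC C gamma z a)))) :
  e != 0 -> [/\ P`_0 = 0, P`_1 = 0
    & P`_2 = - (e ^+ d / e * (2%:R^-1 *
        \sum_r dFz r z a * bilin C rho rho 0 r))].
Proof.
move=> w0; pose e1 := infty_dir c v.
pose s (t : K) := t / (e * (e + t * e1)).
pose S (t : K) := e ^+ 3 * (e + t * e1) ^+ d * (e * (e + t * e1))^-1 ^+ 2 *
  Q_slope C gamma z a rho (s t).
have ds : differentiable s 0 by exact: differentiable_line_param.
have de : differentiable (fun t : K => e + t * e1) 0.
  apply: differentiableD; first exact: differentiable_cst.
  by apply: differentiable_mul => //; exact: differentiable_cst.
have cS : {for 0, continuous S}.
  apply: differentiable_continuous; apply: differentiable_mul; last first.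
    exact: (differentiable_comp ds (differentiable_Q_slope _ _ _ _ _ _)).
  apply: differentiable_mul.
    apply: differentiable_mul; first exact: differentiable_cst.
    exact: differentiable_exp.
  apply/differentiable_exp/differentiableV.
    by apply: differentiable_mul => //; exact: differentiable_cst.
  by rewrite mul0r addr0 mulf_neq0.
have [|p0 p1 p2] := @poly_expansion2 _ P S cS.
  apply: filterS (near_infty_eq_line v w0) => t t0.
  rewrite horner_on_line -/(Fz _ _) FzZ Fz_chart infty_eq_line //.
  rewrite chart_pt_line ?infty_eq_line // -/(s t) -/z -/e -/e1 -/rho.
  rewrite Fz_qC // QC_slope // /S.
  by move: (Q_slope _ _ _ _ _ _) => Q; rewrite /s; field; rewrite w0 andbT.
split=> //; rewrite p2 /S /s !mul0r addr0 Q_slope0.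
by field.
Qed.

Lemma tangency_off_infty w v b (e := infty_eq c w)
    (G := e ^+ 3 *: chart_params c (qC C gamma (chart_pt c w) (chart_params c b))) :
  e != 0 ->
  [/\ Fz w G = 0, \sum_r dFz r w G * v 0 r = 0
    & \sum_r dFz r w b * chart_accel C c w v 0 r +
      \sum_r \sum_s ddFz r s w G * v 0 r * v 0 s =
      d%:R * infty_accel C c w v * Fz w b].
Proof.
move=> w0; have [p0 p1 p2] := QC_chart_order2 v (chart_params c b) w0.
split; first by rewrite /Fz -(coef0_on_line _ _ v).
  by rewrite -coef1_on_line.
have F1 := dFz_chart (chart_accel C c w v) (chart_params c b) w0.
have F0 := Fz_chart (chart_params c b) w0.
rewrite !chart_paramsK in F0 F1; rewrite -coef2_on_line p2 F1 F0.
rewrite chart_dir_accel infty_dir_accel -/e.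
under eq_bigr do rewrite mxE mulrCA.
rewrite -mulr_sumr; move: (\sum_r _) => X; move: (Fz _ _) => Y.
by rewrite /e; field.
Qed.

Lemma eq_off_infty (f g : 'rV[K]_3 -> K) :
  (forall w, differentiable f w) -> (forall w, differentiable g w) ->
  (forall w, infty_eq c w != 0 -> f w = g w) -> f =1 g.
Proof.
move=> df dg fg w; have [w0|/fg//] := eqVneq (infty_eq c w) 0.
case: c w0 fg => [i|] /= w0 fg; last by move/eqP: w0; rewrite oner_eq0.
have dl : differentiable (fun t : K => t *: delta_mx 0 i + w) 0.
  apply: (differentiableD (g := cst w)); last exact: differentiable_cst.
  exact: (differentiableZl (k := id)).
have := @eq_at_puncture _ (fun t : K => f (t *: delta_mx 0 i + w))
  (fun t => g (t *: delta_mx 0 i + w)) 0.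
rewrite scale0r add0r; apply.
- exact/differentiable_continuous/(differentiable_comp dl).
- exact/differentiable_continuous/(differentiable_comp dl).
near=> t; apply: fg; rewrite !mxE !eqxx w0 addr0 mulr1.
by near: t; exact: nbhs_dnbhs_neq.
Unshelve. all: by end_near. Qed.

Lemma chart_field_exists : exists G : 'rV[K]_3 -> params K d -> params K d,
  [/\ forall x, differentiable (fun x => G x.1 x.2) x,
      forall w b, infty_eq c w != 0 ->
        G w b = infty_eq c w ^+ 3 *:
          chart_params c (qC C gamma (chart_pt c w) (chart_params c b))
    & forall w v b,
      [/\ Fz w (G w b) = 0, \sum_r dFz r w (G w b) * v 0 r = 0
        & \sum_r dFz r w b * chart_accel C c w v 0 r +
          \sum_r \sum_s ddFz r s w (G w b) * v 0 r * v 0 s =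
          d%:R * infty_accel C c w v * Fz w b]].
Proof.
have [G [dG GE]] := parameter_field_extends c C gamma_le.
exists G; split=> // w v b.
have dGw x : differentiable (G^~ b) x.
  have db : differentiable (fun y : 'rV[K]_3 => (y, b)) x.
    by apply: differentiable_pair => //; exact: differentiable_cst.
  exact: (differentiable_comp db (dG _)).
have dcst (W : normedModType K) (k : W) (x : 'rV[K]_3) :
  differentiable (fun=> k) x by exact: differentiable_cst.
split; move: w; apply: eq_off_infty.
- by move=> w; exact: differentiable_Fz.
- by [].
- by move=> w w0; rewrite GE //; have [] := tangency_off_infty v b w0.
- move=> w; apply: differentiable_bigsum => r _; apply: differentiable_mul => //.
  exact: differentiable_dFz.
- by [].
- by move=> w w0; rewrite GE //; have [] := tangency_off_infty v b w0.
- move=> w; apply: differentiableD; apply: differentiable_bigsum => r _.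
    apply: differentiable_mul; first exact: differentiable_dFz.
    by apply: differentiable_coef; exact: differentiable_chart_accel.
  apply: differentiable_bigsum => s _.
  by do 2![apply: differentiable_mul => //]; exact: differentiable_ddFz.
- move=> w; apply: differentiable_mul; last exact: differentiable_Fz.
  by apply: differentiable_mul => //; exact: differentiable_infty_accel.
by move=> w w0; rewrite GE //; have [] := tangency_off_infty v b w0.
Qed.

End Identities.

(** * Two-jets under a change of chart *)

Section RationalDerivatives.
Variable K : numFieldType.
Implicit Types (N D : {poly K}) (t : K).

Lemma is_derive_horner N t : is_derive t 1 (horner N) (deriv N).[t].
Proof.
pose P := N \Po ('X + t%:P).
have -> : (deriv N).[t] = (drop_poly 1 P).[0].
  rewrite horner_coef0 coef_drop_poly add0n -[P`_1]mulr1n -coef_deriv.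
  rewrite deriv_comp derivD derivX derivC addr0 mulr1 -horner_coef0.
  by rewrite horner_comp !hornerE.
apply: (is_derive_slope (S := horner (drop_poly 1 P))).
  apply: nearW => h; rewrite [h *: 1]mulr1.
  have P_shift x : P.[x] = N.[x + t] by rewrite horner_comp !hornerE.
  by rewrite -P_shift horner_drop -horner_coef0 P_shift add0r.
by apply: differentiable_continuous; exact: differentiable_horner.
Qed.

Lemma derive1_ratio N D t : D.[t] != 0 ->
  derive1 (fun x => N.[x] / D.[x]) t =
  (deriv N * D - N * deriv D).[t] / (D ^+ 2).[t].
Proof.
move=> D0; have dN := is_derive_horner N t; have dD := is_derive_horner D t.
have dN' : derivable (horner N) t 1 by [].
have dD' : derivable (horner D) t 1 by [].
rewrite derive1E [LHS](deriveM (f := horner N) (g := fun x => (D.[x])^-1)) //; last first.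
  exact: derivableV.
rewrite deriveV // !derive_val !hornerE.
by rewrite /GRing.scale /=; field.
Qed.

Lemma derive1n2_ratio N D : D.[0] != 0 ->
  derive1n 2 (fun x => N.[x] / D.[x]) 0 =
  let M := deriv N * D - N * deriv D in
  (deriv M * D ^+ 2 - M * deriv (D ^+ 2)).[0] / (D ^+ 2 ^+ 2).[0].
Proof.
move=> D0; rewrite derive1nS derive1n1; cbv zeta.
have nearD : \forall x \near (0 : K), D.[x] != 0.
  have cD : {for 0, continuous (horner D : K -> K)}.
    by apply: differentiable_continuous; exact: differentiable_horner.
  exact: cvgr_neq0 cD D0.
rewrite -derive1_ratio; last by rewrite horner_exp expf_neq0.
rewrite !derive1E; apply: near_eq_derive.
by apply: filterS nearD => x Dx; rewrite derive1_ratio.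
Qed.

Definition quad (a b e : K) : {poly K} :=
  a%:P + b *: 'X + (e / 2%:R) *: 'X^2.

Lemma horner_quad a b e t : (quad a b e).[t] = a + t * b + t ^+ 2 / 2%:R * e.
Proof. by rewrite /quad !hornerE /=; field. Qed.

Lemma deriv_quad a b e : deriv (quad a b e) = b%:P + e *: 'X.
Proof.
rewrite /quad !derivD derivC !derivZ derivX derivXn add0r alg_polyC expr1.
by rewrite -scalerMnr scalerMnl -mulr_natr divfK ?pnatr_eq0.
Qed.

Lemma derive1_quad_ratio n0 n1 n2 d0 d1 d2 : d0 != 0 ->
  derive1 (fun x => (quad n0 n1 n2).[x] / (quad d0 d1 d2).[x]) 0 =
  (n1 * d0 - n0 * d1) / d0 ^+ 2.
Proof.
move=> d00; have q0 a b e : (quad a b e).[0] = a by rewrite horner_quad; field.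
rewrite derive1_ratio ?q0 // !deriv_quad !(hornerE, horner_exp) /=.
by rewrite !mulr0 !addr0.
Qed.

Lemma derive1n2_quad_ratio n0 n1 n2 d0 d1 d2 : d0 != 0 ->
  derive1n 2 (fun x => (quad n0 n1 n2).[x] / (quad d0 d1 d2).[x]) 0 =
  (n2 * d0 - n0 * d2) / d0 ^+ 2 - 2%:R * d1 * (n1 * d0 - n0 * d1) / d0 ^+ 3.
Proof.
move=> d00; have q0 a b e : (quad a b e).[0] = a by rewrite horner_quad; field.
rewrite derive1n2_ratio ?q0 //= derivB !derivM !deriv_quad.
rewrite !derivD !derivC !derivZ !derivX.
rewrite !(hornerE, horner_exp, hornerMn) /= !mulr0 !addr0.
by field.
Qed.

End RationalDerivatives.

Section ChartJet.
Variables (K : numFieldType) (d : nat) (c : chart).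
Implicit Types (p : jet K d) (z w v : 'rV[K]_3).

Definition chart_numer j z : K :=
  if c is Some i then if j == i then 1 else z 0 j else z 0 j.

Definition chart_numer_dir j v : K :=
  if c is Some i then if j == i then 0 else v 0 j else v 0 j.

Lemma chart_jet_coord p j :
  (fun t : K => chart_pt c
     (jz p + t *: jxi1 p + (t ^+ 2 / 2%:R) *: jxi2 p) 0 j) =
  fun t => (quad (chart_numer j (jz p)) (chart_numer_dir j (jxi1 p))
              (chart_numer_dir j (jxi2 p))).[t] /
           (quad (infty_eq c (jz p)) (infty_dir c (jxi1 p))
              (infty_dir c (jxi2 p))).[t].
Proof.
apply/funext => t; rewrite !horner_quad /chart_numer /chart_numer_dir.
case: c => [i|] /=; rewrite !mxE; last by rewrite !mulr0 !addr0 divr1.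
by case: eqP => _; rewrite // !mulr0 !addr0 div1r.
Qed.

Lemma chart_jet1 p : in_chart c (jz p) ->
  jxi1 (chart_jet c p) =
  (infty_eq c (jz p) ^+ 2)^-1 *: chart_dir c (jz p) (jxi1 p).
Proof.
rewrite in_chartE => z0; apply/rowP => j; rewrite !mxE.
rewrite (chart_jet_coord p j) derive1_quad_ratio //.
rewrite /chart_numer /chart_numer_dir.
case: c z0 => [i|] /= z0; rewrite ?mxE; last by field.
by case: eqP => [ji|_]; rewrite ?ji; field.
Qed.

Lemma chart_jet2 p : in_chart c (jz p) ->
  jxi2 (chart_jet c p) =
  (infty_eq c (jz p) ^+ 2)^-1 *: chart_dir c (jz p) (jxi2 p) -
  (2%:R * infty_dir c (jxi1 p) / infty_eq c (jz p) ^+ 3) *: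
    chart_dir c (jz p) (jxi1 p).
Proof.
rewrite in_chartE => z0; apply/rowP => j; rewrite !mxE.
rewrite (chart_jet_coord p j) derive1n2_quad_ratio //.
rewrite /chart_numer /chart_numer_dir.
case: c z0 => [i|] /= z0; rewrite ?mxE; last by field.
by case: eqP => [ji|_]; rewrite ?ji; field.
Qed.

End ChartJet.

(** * Fields on the vertical two-jet space *)

Section JetFields.
Variables (K : numFieldType) (d : nat).
Implicit Types (p : jet K d) (z w v : 'rV[K]_3) (a b : params K d).

Lemma univ_polyD a b (h : K) :
  univ_poly (h *: a + b) = h *: univ_poly a + univ_poly b.
Proof.
rewrite /univ_poly scaler_sumr -big_split; apply: eq_bigr => al _ /=.
by rewrite /coef !mxE scalerDl scalerA.
Qed.

Lemma dFzD r w a b (h : K) : dFz r w (h *: a + b) = h * dFz r w a + dFz r w b.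
Proof.
by rewrite /dFz univ_polyD mderivD mderivZ /evalz mevalD mevalZ.
Qed.

Lemma ddFzD r s w a b (h : K) :
  ddFz r s w (h *: a + b) = h * ddFz r s w a + ddFz r s w b.
Proof.
by rewrite /ddFz univ_polyD !(mderivD, mderivZ) /evalz mevalD mevalZ.
Qed.

Lemma jet_line (h : K) z a v w (A : params K d) (B : 'rV[K]_3) :
  h *: ((0, A, 0, B) : jet K d) + (z, a, v, w) =
  (z, h *: A + a, v, h *: B + w).
Proof.
rewrite -[LHS]/(h *: 0 + z, h *: A + a, h *: 0 + v, h *: B + w).
by rewrite !scaler0 !add0r.
Qed.

Lemma jet_scale (h : K) (A : params K d) (B : 'rV[K]_3) :
  h *: ((0, A, 0, B) : jet K d) = (0, h *: A, 0, h *: B).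
Proof. by rewrite -[LHS]/(h *: 0, h *: A, h *: 0, h *: B) !scaler0. Qed.

Lemma tangent_criterion (A : jet K d -> params K d) (B : jet K d -> 'rV[K]_3) :
  (forall p, vertical_jet p ->
    [/\ Fz (jz p) (A p) = 0,
        forall v, \sum_r dFz r (jz p) (A p) * v 0 r = 0
      & \sum_r dFz r (jz p) (ja p) * B p 0 r +
        \sum_r \sum_s ddFz r s (jz p) (A p) * jxi1 p 0 r * jxi1 p 0 s = 0]) ->
  tangent_to_vertical_jets (fun p => (0, A p, 0, B p)).
Proof.
move=> AB p /AB; case: p => [[[z a] v] w] /=.
rewrite /jz /ja /jxi1 /=; move: (A _) (B _) => {A B AB} A B [F0 F1 F2].
split; apply: is_derive_affine => h; rewrite jet_line scaler0 addr0.
- by rewrite /E0 /jz /ja /= FzD F0 mulr0 add0r.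
- rewrite /E1 /jz /ja /jxi1 /=.
  under eq_bigr do rewrite dFzD mulrDl -mulrA.
  by rewrite big_split -mulr_sumr /= F1 mulr0 add0r.
rewrite /E2 /jz /ja /jxi1 /jxi2 /=.
have -> : \sum_r dFz r z (h *: A + a) * (h *: B + w) 0 r =
    h * (\sum_r dFz r z A * (h *: B + w) 0 r) +
    h * (\sum_r dFz r z a * B 0 r) + \sum_r dFz r z a * w 0 r.
  rewrite !mulr_sumr -!big_split; apply: eq_bigr => r _ /=.
  by rewrite dFzD !mxE; ring.
have -> : \sum_r \sum_s ddFz r s z (h *: A + a) * v 0 r * v 0 s =
    h * (\sum_r \sum_s ddFz r s z A * v 0 r * v 0 s) +
    \sum_r \sum_s ddFz r s z a * v 0 r * v 0 s.
  rewrite !mulr_sumr -!big_split; apply: eq_bigr => r _ /=.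
  rewrite !mulr_sumr -!big_split; apply: eq_bigr => s _ /=.
  by rewrite ddFzD; ring.
by rewrite F1 mulr0 add0r addrACA -mulrDr F2 mulr0 add0r.
Qed.

Lemma reparam_equivariant_VC C gamma : reparam_equivariant (@VC K d C gamma).
Proof.
move=> l m [[[z a] v] w] l0; apply: is_derive_affine => h.
rewrite /VC jet_line /reparam /jz /ja /jxi1 /jxi2 /= [RHS]addrC jet_line.
by rewrite bilinZ scalerDr !scalerA [h * _]mulrC addrA.
Qed.

Variables (C : 'I_3 -> 'I_3 -> 'I_3 -> K) (gamma : multinom 3 -> multinom 3).

Lemma chart_dir_chart_pt c z v : infty_eq c z != 0 ->
  chart_dir c (chart_pt c z) ((infty_eq c z ^+ 2)^-1 *: chart_dir c z v) =
  (infty_eq c z ^+ 2)^-1 *: v.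
Proof.
case: c => [i|] /= z0; last by rewrite expr1n invr1 !scale1r.
apply/rowP => j; rewrite !mxE eqxx.
by case: eqP => [ji|_]; rewrite ?ji; field.
Qed.

Lemma chart_accel_chart_pt c z v (e := infty_eq c z) : e != 0 ->
  chart_accel C c (chart_pt c z) ((e ^+ 2)^-1 *: chart_dir c z v) =
  (e ^+ 5)^-1 *: chart_dir c z (bilin C v v).
Proof.
move=> z0; rewrite /chart_accel /infty_accel chart_dir_chart_pt // bilinZ -/e.
move: (bilin C v v) => B; case: c @e z0 => [i|] e /= z0; last first.
  by rewrite /e /= !expr1n invr1 expr1n.
apply/rowP => j; rewrite !mxE eqxx /e /=.
rewrite /e /= in z0; by case: eqP => [ji|_]; rewrite ?ji; field.
Qed.

Definition chart_field c (G : 'rV[K]_3 -> params K d -> params K d) p : jet K d :=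
  (0, G (jz p) (ja p), 0, chart_accel C c (jz p) (jxi1 p)).

Lemma chart_paramsD c a b (h : K) :
  chart_params c (h *: a + b) = h *: chart_params c a + chart_params c b.
Proof. by apply: params_eq => al; rewrite /coef !mxE univ_polyD mcoeffD mcoeffZ. Qed.

Lemma chart_jetE c p : in_chart c (jz p) -> chart_jet c p =
  (chart_pt c (jz p), chart_params c (ja p),
   (infty_eq c (jz p) ^+ 2)^-1 *: chart_dir c (jz p) (jxi1 p),
   (infty_eq c (jz p) ^+ 2)^-1 *: chart_dir c (jz p) (jxi2 p) -
   (2%:R * infty_dir c (jxi1 p) / infty_eq c (jz p) ^+ 3) *:
     chart_dir c (jz p) (jxi1 p)).
Proof. by move=> zc; rewrite -chart_jet1 // -chart_jet2. Qed.

Lemma chart_dirD c w u v (h : K) :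
  chart_dir c w (h *: u + v) = h *: chart_dir c w u + chart_dir c w v.
Proof.
case: c => [i|] //=; apply/rowP => j; rewrite !mxE.
by case: eqP => _; ring.
Qed.

Lemma chart_jet_line c G p (h : K) :
  (forall w b, infty_eq c w != 0 ->
    G w b = infty_eq c w ^+ 3 *:
      chart_params c (qC C gamma (chart_pt c w) (chart_params c b))) ->
  in_chart c (jz p) ->
  chart_jet c (h *: VC C gamma p + p) = chart_jet c p +
    h *: ((infty_eq c (jz (chart_jet c p)) ^+ 3)^-1 *:
          chart_field c G (chart_jet c p)).
Proof.
move=> GE; case: p => [[[z a] v] w] zc; have := zc; rewrite in_chartE /jz /= => z0.
rewrite /VC jet_line chart_jetE // [chart_jet c (z, a, v, w)]chart_jetE //.
rewrite /chart_field /jz /ja /jxi1 /jxi2 /= infty_eq_chart_pt.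
rewrite GE ?infty_eq_chart_pt ?invr_eq0 // chart_ptK // chart_paramsK.
rewrite chart_accel_chart_pt //.
set e := infty_eq c z in z0 *.
rewrite jet_scale !scalerA mulVf ?expf_neq0 ?invr_eq0 // scale1r.
rewrite [RHS]addrC jet_line chart_paramsD chart_dirD scalerDr !scalerA.
congr (_, _, _, _); rewrite addrA; congr (_ *: _ + _ - _).
by field.
Qed.

Hypothesis gamma_le : forall al : multinom 3, mdeg al = d.+1 ->
  (forall j, gamma al j <= al j)%N /\ mdeg (gamma al) = 3%N.

Lemma tangent_chart_field c G :
  (forall w v b,
      [/\ Fz w (G w b) = 0, \sum_r dFz r w (G w b) * v 0 r = 0
        & \sum_r dFz r w b * chart_accel C c w v 0 r +
          \sum_r \sum_s ddFz r s w (G w b) * v 0 r * v 0 s =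
          d%:R * infty_accel C c w v * Fz w b]) ->
  tangent_to_vertical_jets (chart_field c G).
Proof.
move=> GP; apply: tangent_criterion => p [p0 _ _]; split.
- by have [] := GP (jz p) 0 (ja p).
- by move=> v; have [] := GP (jz p) v (ja p).
have [_ _ ->] := GP (jz p) (jxi1 p) (ja p).
by rewrite -/(E0 p) p0 mulr0.
Qed.

Lemma tangent_VC : tangent_to_vertical_jets (@VC K d C gamma).
Proof.
have [G [_ GE GP]] := chart_field_exists None C gamma_le.
have := tangent_chart_field GP; congr tangent_to_vertical_jets.
have params_id a : chart_params None a = a.
  by apply: params_eq => al; rewrite -[RHS]mcoeff_univ_poly /coef mxE enum_rankK.
apply/funext => p; rewrite /chart_field GE ?oner_neq0 //.
by rewrite expr1n scale1r !params_id.
Qed.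

Lemma homogenises_VC : homogenises_with_twist 3 (@VC K d C gamma).
Proof.
move=> c; have [G [dG GE GP]] := chart_field_exists c C gamma_le.
exists (chart_field c G); split.
- move=> p.
  have dz : differentiable (@jz K d) p.
    by do 3!apply: differentiable_fst.
  have da : differentiable (@ja K d) p.
    by apply: differentiable_snd; do 2!apply: differentiable_fst.
  have dx : differentiable (@jxi1 K d) p.
    by apply: differentiable_snd; apply: differentiable_fst.
  have dza := differentiable_pair dz da.
  apply: differentiable_pair; last exact: differentiable_chart_accel.
  apply: differentiable_pair; last exact: differentiable_cst.
  apply: differentiable_pair; first exact: differentiable_cst.
  exact: (differentiable_comp dza (dG _)).
- exact: tangent_chart_field.
by move=> p _ zc; apply: is_derive_affine => h; exact: chart_jet_line.
Qed.

End JetFields.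

(** * The second Semple stage *)

Section Semple.
Variables (K : numFieldType) (d : nat).
Variables (C : 'I_3 -> 'I_3 -> 'I_3 -> K) (c : chart) (k m n : 'I_3).
Hypothesis kmn : frame k m n.
Implicit Types (p : jet K d) (x : semple K d).

Lemma sum_frame (f : 'I_3 -> K) : \sum_r f r = f k + f m + f n.
Proof.
have [||_ kmnE] := @uniq_min_size _ [:: k; m; n] (enum 'I_3) kmn.
- by move=> r _; rewrite mem_enum.
- by rewrite size_enum_ord.
rewrite -[LHS]big_enum (perm_big [:: k; m; n]).
  by rewrite !big_cons big_nil /= addr0 addrA.
by rewrite uniq_perm ?enum_uniq // => r; rewrite kmnE.
Qed.

(* The velocity, normalized by [x = 1], of the jets over a point of X_1. *)
Definition frame_dir x : 'rV[K]_3 :=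
  \row_j (if j == m then 1 else if j == n then x.1.2
          else - (dFz m (sz x) (sa x) + x.1.2 * dFz n (sz x) (sa x))
               / dFz k (sz x) (sa x)).

Definition semple_rate x : K :=
  chart_accel C c (sz x) (frame_dir x) 0 n
    - x.1.2 * chart_accel C c (sz x) (frame_dir x) 0 m.

Definition semple_field (stat : bool) (G : 'rV[K]_3 -> params K d -> params K d)
    x : semple K d :=
  (0, G (sz x) (sa x), 0,
   if stat then - x.2 ^+ 2 * semple_rate x else semple_rate x).

Lemma differentiable_semple_field stat G x :
  (forall y, differentiable (fun y => G y.1 y.2) y) ->
  dFz k (sz x) (sa x) != 0 -> differentiable (semple_field stat G) x.
Proof.
move=> dG Fk.
have dz : differentiable (@sz K d) x by do 3!apply: differentiable_fst.
have da : differentiable (@sa K d) x.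
  by apply: differentiable_snd; do 2!apply: differentiable_fst.
have du : differentiable (fun y : semple K d => y.1.2) x.
  by apply: differentiable_snd; apply: differentiable_fst.
have ds : differentiable (fun y : semple K d => y.2) x.
  exact: differentiable_snd.
have ddir : differentiable frame_dir x.
  apply: differentiable_row => j; under eq_fun do rewrite mxE.
  case: eqP => _; first exact: differentiable_cst.
  case: eqP => _ //; apply: differentiable_mul; last first.
    by apply: differentiableV => //; exact: differentiable_dFz.
  apply: differentiableN; apply: differentiableD; first exact: differentiable_dFz.
  by apply: differentiable_mul => //; exact: differentiable_dFz.
have dacc := differentiable_chart_accel C c dz ddir.
have drate : differentiable semple_rate x.
  apply: differentiableB; first exact: (differentiable_coef _ dacc).
  by apply: differentiable_mul => //; exact: (differentiable_coef _ dacc).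
have dza := differentiable_pair dz da.
apply: differentiable_pair; last first.
  case: stat => //; apply: differentiable_mul => //.
  by apply: differentiableN; exact: differentiable_exp.
apply: differentiable_pair; last exact: differentiable_cst.
apply: differentiable_pair; first exact: differentiable_cst.
exact: (differentiable_comp dza (dG _)).
Qed.

Lemma semple_line (h : K) (z : 'rV[K]_3) (a A : params K d) (u s S : K) :
  h *: ((0, A, 0, S) : semple K d) + (z, a, u, s) = (z, h *: A + a, u, h * S + s).
Proof.
rewrite -[LHS]/(h *: 0 + z, h *: A + a, h *: 0 + u, h *: S + s).
by rewrite !scaler0 !add0r.
Qed.

Lemma tangent_semple_field stat G x : (forall w b, Fz w (G w b) = 0) ->
  is_derive x (semple_field stat G x)
    (fun y : semple K d => Fz (sz y) (sa y)) 0.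
Proof.
move=> G0; apply: is_derive_affine => h; rewrite /semple_field.
case: x => [[[z a] u] s]; rewrite semple_line /sz /sa /= FzD G0.
by rewrite mulr0 scaler0 addr0 add0r.
Qed.

Lemma frame_dir_lift stat p : E1 p = 0 -> dFz k (jz p) (ja p) != 0 ->
  jxi1 p 0 m != 0 ->
  jxi1 p = jxi1 p 0 m *: frame_dir (semple_lift m n stat p).
Proof.
move=> + Fk x0; rewrite /E1 sum_frame => E1p.
have /and3P[] := kmn; rewrite !inE negb_or andbT => /andP[km kn] mn _.
apply/rowP => j; rewrite !mxE /semple_lift /sz /sa /=.
have [->|jm] := eqVneq j m; first by rewrite mulr1.
have [->|jn] := eqVneq j n; first by rewrite mulrC divfK.
have -> : j = k.
  have := sum_frame (fun r => (r == j)%:R); rewrite (bigD1 j) //= eqxx.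
  rewrite big1 => [|r /negbTE-> //].
  rewrite ![_ == j]eq_sym (negbTE jm) (negbTE jn) !addr0.
  by case: eqP => // _ /eqP; rewrite oner_eq0.
apply: (mulfI Fk); apply/eqP; rewrite -subr_eq0 -[X in _ == X]E1p; apply/eqP.
by field; rewrite Fk.
Qed.

Lemma semple_rate_lift stat p (e : K) : E1 p = 0 ->
  dFz k (jz p) (ja p) != 0 -> jxi1 p 0 m != 0 ->
  let B := e *: chart_accel C c (jz p) (jxi1 p) in
  (jxi1 p 0 m * B 0 n - jxi1 p 0 n * B 0 m) / jxi1 p 0 m ^+ 3 =
  e * semple_rate (semple_lift m n stat p).
Proof.
move=> E1p Fk x0 /=; rewrite [in chart_accel _ _ _ _](frame_dir_lift stat E1p Fk x0).
rewrite chart_accelZ /semple_rate.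
set x := semple_lift _ _ _ _; rewrite -[sz x]/(jz p).
rewrite -[x.1.2]/(jxi1 p 0 n / jxi1 p 0 m).
move: (chart_accel _ _ _ _) => v; rewrite !mxE.
by field.
Qed.

Lemma lift_line stat p (A : params K d) (B : 'rV[K]_3) (S : K) :
  lifts_in k m n stat p ->
  let q' := (jxi1 p 0 m * B 0 n - jxi1 p 0 n * B 0 m) / jxi1 p 0 m ^+ 3 in
  S = (if stat then - (semple_lift m n stat p).2 ^+ 2 * q' else q') ->
  exists2 T : K -> semple K d, {for 0, continuous T} /\ T 0 = (0, A, 0, S)
  & \forall h \near 0^',
      semple_lift m n stat (p + h *: ((0, A, 0, B) : jet K d)) =
      semple_lift m n stat p + h *: T h.
Proof.
move=> /and3P[_ x0 W0] q' ->.
pose q := wronskian m n p / jxi1 p 0 m ^+ 3.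
have lift h : semple_lift m n stat (p + h *: ((0, A, 0, B) : jet K d)) =
  (jz p, h *: A + ja p, jxi1 p 0 n / jxi1 p 0 m,
   if stat then (q + h * q')^-1 else q + h * q').
  case: p @q @q' x0 {W0} => [[[z a] v] w] q q' x0.
  rewrite addrC jet_line /semple_lift /wronskian /jz /ja /jxi1 /jxi2 /=.
  rewrite /jxi1 /= in x0.
  suff -> : (v 0 m * (h *: B + w) 0 n - v 0 n * (h *: B + w) 0 m) / v 0 m ^+ 3 =
      q + h * q' by [].
  by rewrite /q /q' /wronskian /jxi1 /jxi2 !mxE /=; field.
case: stat W0 lift => /= W0 lift; last first.
  exists (fun=> (0, A, 0, q')); first by split=> //; exact: cst_continuous.
  apply: nearW => h; rewrite lift [RHS]addrC semple_line.
  by rewrite [q + _]addrC.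
have q0 : q != 0 by rewrite mulf_neq0 // invr_eq0 expf_neq0.
have dq : differentiable (fun h : K => q + h * q') 0.
  apply: differentiableD; first exact: differentiable_cst.
  by apply: differentiable_mul => //; exact: differentiable_cst.
have q00 : q + 0 * q' != 0 by rewrite mul0r addr0.
exists (fun h => (0, A, 0, - q' / (q * (q + h * q')))); first split.
- apply: differentiable_continuous.
  apply: differentiable_pair; first exact: differentiable_cst.
  apply: differentiable_mul; first exact: differentiable_cst.
  apply: differentiableV; last by rewrite mulf_neq0.
  by apply: differentiable_mul => //; exact: differentiable_cst.
- by rewrite mul0r addr0; congr (_, _, _, _); rewrite -/q; field.
have nq : \forall h \near (0 : K)^', q + h * q' != 0.
  apply: (near_puncture_neq (f := fun h : K => q + h * q')) q00.
  exact: differentiable_continuous.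
apply: filterS nq => h hq; rewrite lift [RHS]addrC semple_line.
congr (_, _, _, _); rewrite /= -/q.
by field; rewrite q0.
Qed.

End Semple.

Lemma extends_VC (K : numFieldType) (d : nat) (C : 'I_3 -> 'I_3 -> 'I_3 -> K)
    (gamma : multinom 3 -> multinom 3) :
  (forall al : multinom 3, mdeg al = d.+1 ->
     (forall j, gamma al j <= al j)%N /\ mdeg (gamma al) = 3%N) ->
  extends_over_second_semple_stage 3 (@VC K d C gamma).
Proof.
move=> gamma_le c k m n stat kmn.
have [G [dG GE GP]] := chart_field_exists c C gamma_le.
have G0 w b : Fz w (G w b) = 0 by have [] := GP w 0 b.
exists (semple_field C c k m n stat G); split.
  split=> x Fk; first exact: differentiable_semple_field.
  by move=> _; exact: tangent_semple_field.
move=> p [p0 p1 _] zc; set p' := chart_jet c p => lp.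
have z0 : infty_eq c (jz p) != 0 by rewrite -in_chartE.
have w0 : infty_eq c (jz p') != 0.
  by rewrite /p' chart_jetE // infty_eq_chart_pt invr_eq0.
have E1p' : E1 p' = 0.
  rewrite /E1 /p' chart_jetE // /jz /ja /jxi1 /= dFz_chart; last first.
    by rewrite infty_eq_chart_pt invr_eq0.
  rewrite chart_ptK //; move: p0; rewrite /E0 => ->.
  rewrite chart_dir_chart_pt // mulr0 add0r.
  under eq_bigr do rewrite mxE mulrCA.
  by rewrite -mulr_sumr -/(E1 p) p1 !mulr0.
set e3 := (infty_eq c (jz p') ^+ 3)^-1.
pose x := semple_lift m n stat p'; pose A := e3 *: G (jz p') (ja p').
pose B := e3 *: chart_accel C c (jz p') (jxi1 p').
have [Fk x0 W0] : [/\ dFz k (jz p') (ja p') != 0, jxi1 p' 0 m != 0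
    & stat ==> (wronskian m n p' != 0)] by have /and3P := lp.
have rateE : (jxi1 p' 0 m * B 0 n - jxi1 p' 0 n * B 0 m) / jxi1 p' 0 m ^+ 3 =
    e3 * semple_rate C c k m n x by exact: semple_rate_lift.
have [|T [cT T0] Tlift] := @lift_line K d k m n stat p' A B
  (e3 * if stat then - x.2 ^+ 2 * semple_rate C c k m n x
        else semple_rate C c k m n x) lp.
  by rewrite rateE; case: stat @x {lp W0 rateE} => x //; rewrite mulrCA.
have -> : e3 *: semple_field C c k m n stat G x = T 0.
  rewrite T0 /semple_field -/x -[LHS]/(e3 *: 0, A, e3 *: 0, e3 * _).
  by rewrite !scaler0.
apply: is_derive_slope cT; apply: filterS Tlift => h /= <-.
by rewrite (chart_jet_line _ GE) // -jet_scale.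
Qed.

Theorem proposition2p21 (R : realType) (d : nat)
    (C : 'I_3 -> 'I_3 -> 'I_3 -> CC R)
    (C_sym : forall r j k, C r j k = C r k j)
    (gamma : multinom 3 -> multinom 3)
    (gamma_le : forall al : multinom 3, mdeg al = d.+1 ->
       (forall j, gamma al j <= al j)%N /\ mdeg (gamma al) = 3%N) :
  [/\ tangent_to_vertical_jets (@VC (CC R) d C gamma),
      reparam_equivariant (@VC (CC R) d C gamma),
      homogenises_with_twist 3 (@VC (CC R) d C gamma)
    & extends_over_second_semple_stage 3 (@VC (CC R) d C gamma)].
Proof.
split; [exact: tangent_VC|exact: reparam_equivariant_VC|exact: homogenises_VC|].
exact: extends_VC.
Qed.
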